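(* Consider the variance reduced SQP algorithm described in the context with the adaptive step size rule with parameters $\alpha_u$ and $\beta$, under all standing assumptions listed there (including the merit parameter assumption with $\bar k_\tau$, $\bar\tau_{\min}$). Let $\alpha_l:=\frac{\kappa_l\bar\tau_{\min}}{\bar\tau_{\min}L+\Gamma}$ with $\alpha_l<\alpha_u$, let $\gamma\in(0,1]$ and $b<N^{\gamma}$. There exist universal constants $\mu_1\in(0,1]$ and $\nu_1>0$ such that the following holds. Suppose $$\beta=\frac{\mu_1 b}{(\bar\tau_{\min}L+\Gamma)N^{\gamma}}\in(0,1],\qquad \frac{\beta\kappa_l\bar\tau_{\min}}{\bar\tau_{\min}L+\Gamma}\in(0,1],\qquad z=\frac{\bar\tau_{\min}L+\Gamma}{N^{\gamma/2}},$$ $$S\le\left\lfloor\frac{N^{\gamma/2}}{(\bar\tau_{\min}L+\Gamma)+\frac{\mu_1^2\alpha_u^2L^2b}{(\bar\tau_{\min}L+\Gamma)^3\kappa_l\zeta}+\frac{\mu_1^2\alpha_u^2L^2b}{(\bar\tau_{\min}L+\Gamma)^2\kappa_l\zeta}}\right\rfloor .$$ Define $\lambda_S=0$ and, for $s\in\{0,\dots,S-1\}$, $$\lambda_s=\lambda_{s+1}(1+z)\left(1+\frac{\alpha_u^2\beta^2L^2}{\kappa_l z b\zeta}\right)+\frac{\alpha_u\bar\tau_{\min}L^2}{2b}\left(\kappa_H\kappa_d+\frac{\beta^2}{\zeta}\right),$$ $$\Lambda_s=\alpha_l\beta-\tfrac12\alpha_u\beta^2-\frac{\alpha_u\kappa_H\kappa_d\beta^2}{2\kappa_l}-\lambda_{s+1}(1+z)\frac{\alpha_u^2\beta^2}{\bar\tau_{\min}\kappa_l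 z},$$ and $\Lambda_{\min}=\min_{0\le s\le S-1}\Lambda_s$. Then $\Lambda_{\min}\ge\frac{\nu_1 b}{(\bar\tau_{\min}L+\Gamma)N^{\gamma}}$ and, for all $k\ge\bar k_\tau$, $$\mathbb{E}_{\tau_{\min}}\left[\frac{1}{(k-\bar k_\tau+1)S}\sum_{j=\bar k_\tau}^{k}\sum_{s=0}^{S-1}\Delta l(x_{j,s},\bar\tau_{\min},g_{j,s},d_{j,s})\right]\le\frac{(\bar\tau_{\min}L+\Gamma)N^{\gamma}\left(\mathbb{E}_{\tau_{\min}}[\phi(x_{\bar k_\tau,0},\bar\tau_{\min})]-\phi_{\inf}\right)}{(k-\bar k_\tau+1)S\nu_1 b}.$$
   Context: Problem: $\min_{x\in\mathbb{R}^n} f(x)$ s.t. $c(x)=0$, with $f=\frac1N\sum_{i=1}^N f_i$, $f_i:\mathbb{R}^n\to\mathbb{R}$, $c:\mathbb{R}^n\to\mathbb{R}^m$. Indices: $k\in\mathbb{N}=\{0,1,\dots\}$ (outer), $s\in\{0,\dots,S-1\}$ (inner). Write $g=\nabla f$, $J=\nabla c^T$ ($m\times n$ Jacobian), and $f_{k,s}=f(x_{k,s})$, $g_{k,s}=\nabla f(x_{k,s})$, $c_{k,s}=c(x_{k,s})$, $J_{k,s}=J(x_{k,s})$. Smoothness assumption: $\mathcal X\subseteq\mathbb{R}^n$ is an open convex set containing all iterates $x_{k,s}$ of any run. $f$ and $\nabla f$ are bounded over $\mathcal X$; each $f_i$ is continuously differentiable with $L$-Lipschitz gradient; each $c_i$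 is continuously differentiable and bounded over $\mathcal X$, with $\gamma_i$-Lipschitz gradient, $\gamma_i>0$, and $\Gamma:=\sum_{i=1}^m\gamma_i$; $J$ is bounded over $\mathcal X$ with singular values bounded away from zero over $\mathcal X$. Matrices: $H_{k,s}\in\mathbb{R}^{n\times n}$ are symmetric, the sequence $\{H_{k,s}\}$ is independent of $\{\bar g_{k,s}\}$ and bounded in norm by $\kappa_H>0$, and there is $\zeta>0$ with $u^TH_{k,s}u\ge\zeta\|u\|_2^2$ whenever $J_{k,s}u=0$. Gradient estimates: with a random mini-batch $I_{k,s}\subset\{1,\dots,N\}$ of size $b\in\{1,\dots,N-1\}$, $\tilde g_{k,s}=\frac1b\sum_{i\in I_{k,s}}\nabla f_i(x_{k,s})$ and $\bar g_{k,s}=\frac1b\sum_{i\in I_{k,s}}\left(\nabla f_i(x_{k,s})-(\nabla f_i(x_{k,0})-\nabla f(x_{k,0}))\right)$. $\mathbb{E}_{k,s}$ is expectation conditioned on the algorithm having reached $x_{k,0}$ and $x_{k,s}$ (and, where the merit parameter assumption below is in force, also on the event $E_{\tau_{\min}}$). Assumed: $\mathbb{E}_{k,s}[\tilde g_{k,s}]=g_{k,s}$, hence $\mathbb{E}_{k,s}[\bar g_{k,s}]=g_{k,s}$, and $\mathbb{E}_{k,s}[\|\bar g_{k,s}-g_{k,s}\|_2^2]\le M_{k,s}:=\frac{L^2}{b}\|x_{k,s}-x_{k,0}\|_2^2$. Merit function: $\phi(x,\tau)=\tau f(x)+\|c(x)\|_1$. For $d$ with $c(x)+\nabla c(x)^Td=0$: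 $\Delta l(x,\tau,g,d)=-\tau g^Td+\|c(x)\|_1$. Algorithm: inputs $x_{-1,S}$, $\bar\tau_{-1,S-1}>0$, $\epsilon_\tau,\sigma\in(0,1)$, $b$, $S\ge1$. For each $k$: $x_{k,0}=x_{k-1,S}$, $\bar\tau_{k,-1}=\bar\tau_{k-1,S-1}$. For each $s$: form $\bar g_{k,s}$ and solve $\begin{bmatrix}H_{k,s}&J_{k,s}^T\\ J_{k,s}&0\end{bmatrix}\begin{bmatrix}\bar d_{k,s}\\ \bar y_{k,s}\end{bmatrix}=-\begin{bmatrix}\bar g_{k,s}\\ c_{k,s}\end{bmatrix}$. If $\bar d_{k,s}=0$, set $x_{k,s+1}=x_{k,s}$, $\bar\tau_{k,s}=\bar\tau_{k,s-1}$ and go to the next inner iteration. Otherwise let $q=\bar g_{k,s}^T\bar d_{k,s}+\max\{\bar d_{k,s}^TH_{k,s}\bar d_{k,s},0\}$; set $\bar\tau^{trial}_{k,s}=\infty$ if $q\le0$ and $\bar\tau^{trial}_{k,s}=(1-\sigma)\|c_{k,s}\|_1/q$ otherwise; set $\bar\tau_{k,s}=\bar\tau_{k,s-1}$ if $\bar\tau_{k,s-1}\le\bar\tau^{trial}_{k,s}$ and $\bar\tau_{k,s}=(1-\epsilon_\tau)\bar\tau^{trial}_{k,s}$ otherwise. Choose the step size $\bar\alpha_{k,s}$ and set $x_{k,s+1}=x_{k,s}+\bar\alpha_{k,s}\bar d_{k,s}$. Adaptive step size option (parameters $\beta\in(0,1]$, $\alpha_u>0$): $\bar{\widehat\alpha}_{k,s}=\min\left\{\frac{\Delta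 l(x_{k,s},\bar\tau_{k,s},\bar g_{k,s},\bar d_{k,s})}{(\bar\tau_{k,s}L+\Gamma)\|\bar d_{k,s}\|_2^2},\alpha_u\right\}\beta$, $\bar{\widetilde\alpha}_{k,s}=\bar{\widehat\alpha}_{k,s}-\frac{4\|c_{k,s}\|_1}{(\bar\tau_{k,s}L+\Gamma)\|\bar d_{k,s}\|_2^2}$, and $\bar\alpha_{k,s}=\bar{\widehat\alpha}_{k,s}$ if $\bar{\widehat\alpha}_{k,s}<1$; $\bar\alpha_{k,s}=1$ if $\bar{\widetilde\alpha}_{k,s}\le1\le\bar{\widehat\alpha}_{k,s}$; $\bar\alpha_{k,s}=\bar{\widetilde\alpha}_{k,s}$ if $\bar{\widetilde\alpha}_{k,s}>1$. Deterministic counterparts: $(d_{k,s},y_{k,s})$ solves the same linear system with $\bar g_{k,s}$ replaced by $g_{k,s}$; $\tau^{trial}_{k,s}$ is defined like $\bar\tau^{trial}_{k,s}$ with $(\bar g_{k,s},\bar d_{k,s})$ replaced by $(g_{k,s},d_{k,s})$. Merit parameter assumption: the event $E_{\tau_{\min}}$ occurs that there exist $\bar k_\tau\in\mathbb{N}$ and $\bar\tau_{\min}>0$ with $\bar\tau_{k,s}=\bar\tau_{\min}\le\tau^{trial}_{k,s}$ for all $k\ge\bar k_\tau$ and all $s\in\{0,\dots,S-1\}$; moreover the unbiasedness above holds conditionally on $E_{\tau_{\min}}$. $\mathbb{E}_{\tau_{\min}}$ denotes total expectation conditioned on this assumption. $\phi_{\inf}:=\inf_{x\in\mathcal X}\phi(x,\bar\tau_{\min})>-\infty$.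 $\kappa_l>0$ is a constant (it exists by a preliminary lemma of the paper) such that $\Delta l(x_{k,s},\bar\tau_{k,s},g_{k,s},d_{k,s})\ge\kappa_l\bar\tau_{k,s}\|d_{k,s}\|_2^2$ and $\Delta l(x_{k,s},\bar\tau_{k,s},\bar g_{k,s},\bar d_{k,s})\ge\kappa_l\bar\tau_{k,s}\|\bar d_{k,s}\|_2^2$ for all $(k,s)$. $\kappa_d>0$ is a constant, independent of $(k,s)$ and of the run (it exists by a preliminary lemma), with $\mathbb{E}_{k,s}[\|\bar d_{k,s}-d_{k,s}\|_2]\le\kappa_d\sqrt{M_{k,s}}$. ''Universal'' constants are independent of $N$, $k$ and $s$. If $\bar d_{k,s}=0$ the value of $\bar\alpha_{k,s}$ is immaterial and may be taken to be any number in $[\alpha_l\beta,\alpha_u\beta]$. *)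

(* Defs.v *)
From HB Require Import structures.
From mathcomp Require Import all_boot all_order all_algebra.
From mathcomp Require Import all_classical all_reals all_analysis.

Set Implicit Arguments.
Unset Strict Implicit.
Unset Printing Implicit Defensive.

Import Order.TTheory GRing.Theory Num.Theory.
Import numFieldNormedType.Exports.

Local Open Scope classical_set_scope.
Local Open Scope ring_scope.

(* The library's norm on matrices is the max norm; the algorithm uses the
   Euclidean and the l1 norm. *)
Definition dot (R : realType) (n : nat) (u v : 'cV[R]_n) : R :=
  \sum_(i < n) u i 0 * v i 0.

Definition norm2 (R : realType) (n : nat) (u : 'cV[R]_n) : R :=
  Num.sqrt (dot u u).

Definition norm1 (R : realType) (n : nat) (u : 'cV[R]_n) : R :=
  \sum_(i < n) `|u i 0|.

Definition grad (R : realType) (n : nat) (f : 'cV[R]_n -> R) (x : 'cV[R]_n) :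
    'cV[R]_n :=
  \col_(j < n) 'd f x (delta_mx j 0).

Definition coordf (R : realType) (n m : nat) (c : 'cV[R]_n -> 'cV[R]_m)
    (i : 'I_m) (x : 'cV[R]_n) : R :=
  c x i 0.

(* Row i of J(x) is the transposed gradient of c_i at x. *)
Definition jac (R : realType) (n m : nat) (c : 'cV[R]_n -> 'cV[R]_m)
    (x : 'cV[R]_n) : 'M[R]_(m, n) :=
  \matrix_(i < m, j < n) grad (coordf c i) x j 0.

Definition lipschitz2_on (R : realType) (n p : nat) (K : R)
    (X : set 'cV[R]_n) (h : 'cV[R]_n -> 'cV[R]_p) : Prop :=
  forall x y, X x -> X y -> norm2 (h x - h y) <= K * norm2 (x - y).

(* The m singular values of an m x n matrix, m <= n.  For m > n the value 0 is
   always among them, so that bounding them away from 0 means full row rank. *)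
Definition singular_value (R : realType) (m n : nat) (A : 'M[R]_(m, n))
    (s : R) : Prop :=
  0 <= s /\ eigenvalue (A *m A^T) (s ^+ 2).

Definition favg (R : realType) (n N : nat) (f : 'I_N -> 'cV[R]_n -> R)
    (x : 'cV[R]_n) : R :=
  N%:R^-1 * \sum_(i < N) f i x.

Record smooth_problem (R : realType) (n m N : nat) (X : set 'cV[R]_n)
    (f : 'I_N -> 'cV[R]_n -> R) (c : 'cV[R]_n -> 'cV[R]_m)
    (L : R) (gam : 'I_m -> R) : Prop := {
  sp_open : open X ;
  sp_convex : convex_set (X : set (convex_lmodType 'cV[R]_n)) ;
  sp_f_bounded : [bounded favg f x | x in X] ;
  sp_gradf_bounded : [bounded grad (favg f) x | x in X] ;
  sp_fi_diff : forall i x, X x -> differentiable (f i) x ;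
  sp_fi_C1 : forall i x, X x -> {for x, continuous (grad (f i))} ;
  sp_fi_lip : forall i, lipschitz2_on L X (grad (f i)) ;
  sp_ci_diff : forall i x, X x -> differentiable (coordf c i) x ;
  sp_ci_C1 : forall i x, X x -> {for x, continuous (grad (coordf c i))} ;
  sp_ci_bounded : forall i, [bounded coordf c i x | x in X] ;
  sp_ci_lip : forall i, lipschitz2_on (gam i) X (grad (coordf c i)) ;
  sp_jac_bounded : [bounded jac c x | x in X] ;
  sp_jac_sv : exists2 smin : R, 0 < smin &
    forall x s, X x -> singular_value (jac c x) s -> smin <= s }.

Definition phi (R : realType) (n m N : nat) (f : 'I_N -> 'cV[R]_n -> R)
    (c : 'cV[R]_n -> 'cV[R]_m) (x : 'cV[R]_n) (tau : R) : R :=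
  tau * favg f x + norm1 (c x).

(* Model reduction Delta l, as a function of the value cx = c(x).  Meaningful
   for d with c(x) + J(x) d = 0. *)
Definition dl (R : realType) (n m : nat) (cx : 'cV[R]_m) (tau : R)
    (g d : 'cV[R]_n) : R :=
  - tau * dot g d + norm1 cx.

Definition gtilde (R : realType) (n N : nat) (f : 'I_N -> 'cV[R]_n -> R)
    (b : nat) (B : {set 'I_N}) (x : 'cV[R]_n) : 'cV[R]_n :=
  b%:R^-1 *: \sum_(i in B) grad (f i) x.

Definition gbar (R : realType) (n N : nat) (f : 'I_N -> 'cV[R]_n -> R)
    (b : nat) (B : {set 'I_N}) (x0 x : 'cV[R]_n) : 'cV[R]_n :=
  b%:R^-1 *:
    \sum_(i in B) (grad (f i) x - (grad (f i) x0 - grad (favg f) x0)).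

Definition sqp_system (R : realType) (n m : nat) (H : 'M[R]_n)
    (J : 'M[R]_(m, n)) (g : 'cV[R]_n) (cx : 'cV[R]_m)
    (d : 'cV[R]_n) (y : 'cV[R]_m) : Prop :=
  H *m d + J^T *m y = - g /\ J *m d = - cx.

Definition tau_trial (R : realType) (n m : nat) (sigma : R) (cx : 'cV[R]_m)
    (H : 'M[R]_n) (g d : 'cV[R]_n) : \bar R :=
  let q := dot g d + Num.max (dot d (H *m d)) 0 in
  if q <= 0 then +oo%E else ((1 - sigma) * norm1 cx / q)%:E.

Definition tau_update (R : realType) (epstau tau : R) (trial : \bar R) : R :=
  if (tau%:E <= trial)%E then tau else (1 - epstau) * fine trial.

Definition adaptive_step (R : realType) (n m : nat) (L Gam au beta : R)
    (cx : 'cV[R]_m) (tau : R) (g d : 'cV[R]_n) : R :=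
  let den := (tau * L + Gam) * norm2 d ^+ 2 in
  let ahat := Num.min (dl cx tau g d / den) au * beta in
  let atilde := ahat - 4 * norm1 cx / den in
  if ahat < 1 then ahat else if atilde <= 1 then 1 else atilde.

(* One run of the algorithm.  The merit parameter is stored with the index
   shifted by one, next to the iterate: [tr_tau t k s] is the value held on
   entering inner iteration (k, s), so that bar tau_{k,s} is [tr_tau t k s.+1]
   and bar tau_{k,-1} is [tr_tau t k 0]. *)
Record trajectory (R : realType) (n m N : nat) := Trajectory {
  tr_x : nat -> nat -> 'cV[R]_n ;
  tr_tau : nat -> nat -> R ;
  tr_batch : nat -> nat -> {set 'I_N} ;
  tr_H : nat -> nat -> 'M[R]_n ;
  tr_dbar : nat -> nat -> 'cV[R]_n ;
  tr_ybar : nat -> nat -> 'cV[R]_m ;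
  tr_d : nat -> nat -> 'cV[R]_n ;
  tr_y : nat -> nat -> 'cV[R]_m }.

Section Trajectory.
Context (R : realType) (n m N : nat).
Context (f : 'I_N -> 'cV[R]_n -> R) (c : 'cV[R]_n -> 'cV[R]_m).
Implicit Type t : trajectory R n m N.

Definition tr_g t (k s : nat) : 'cV[R]_n := grad (favg f) (tr_x t k s).
Definition tr_c t (k s : nat) : 'cV[R]_m := c (tr_x t k s).
Definition tr_J t (k s : nat) : 'M[R]_(m, n) := jac c (tr_x t k s).
Definition tr_gtilde (b : nat) t (k s : nat) : 'cV[R]_n :=
  gtilde f b (tr_batch t k s) (tr_x t k s).
Definition tr_gbar (b : nat) t (k s : nat) : 'cV[R]_n :=
  gbar f b (tr_batch t k s) (tr_x t k 0) (tr_x t k s).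
Definition tr_taubar t (k s : nat) : R := tr_tau t k s.+1.
Definition tr_trial (sigma : R) t (k s : nat) : \bar R :=
  tau_trial sigma (tr_c t k s) (tr_H t k s) (tr_g t k s) (tr_d t k s).
Definition tr_trialbar (sigma : R) (b : nat) t (k s : nat) : \bar R :=
  tau_trial sigma (tr_c t k s) (tr_H t k s) (tr_gbar b t k s) (tr_dbar t k s).
Definition tr_M (L : R) (b : nat) t (k s : nat) : R :=
  L ^+ 2 / b%:R * norm2 (tr_x t k s - tr_x t k 0) ^+ 2.
Definition tr_dl t (tau : R) (k s : nat) : R :=
  dl (tr_c t k s) tau (tr_g t k s) (tr_d t k s).
Definition tr_dlbar (b : nat) t (tau : R) (k s : nat) : R :=
  dl (tr_c t k s) tau (tr_gbar b t k s) (tr_dbar t k s).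

Record vr_sqp_run (L Gam sigma epstau au beta : R) (b S : nat)
    (xinit : 'cV[R]_n) (tauinit : R) t : Prop := {
  run_x_init : tr_x t 0 0 = xinit ;
  run_tau_init : tr_tau t 0 0 = tauinit ;
  run_x_outer : forall k, tr_x t k.+1 0 = tr_x t k S ;
  run_tau_outer : forall k, tr_tau t k.+1 0 = tr_tau t k S ;
  run_batch : forall k s, (s < S)%N -> #|tr_batch t k s| = b ;
  run_system : forall k s, (s < S)%N ->
    sqp_system (tr_H t k s) (tr_J t k s) (tr_gbar b t k s) (tr_c t k s)
      (tr_dbar t k s) (tr_ybar t k s) ;
  run_det_system : forall k s, (s < S)%N ->
    sqp_system (tr_H t k s) (tr_J t k s) (tr_g t k s) (tr_c t k s)
      (tr_d t k s) (tr_y t k s) ;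
  run_tau : forall k s, (s < S)%N ->
    tr_tau t k s.+1 =
      if tr_dbar t k s == 0 then tr_tau t k s
      else tau_update epstau (tr_tau t k s) (tr_trialbar sigma b t k s) ;
  run_x : forall k s, (s < S)%N ->
    tr_x t k s.+1 =
      if tr_dbar t k s == 0 then tr_x t k s
      else tr_x t k s +
        adaptive_step L Gam au beta (tr_c t k s) (tr_taubar t k s)
          (tr_gbar b t k s) (tr_dbar t k s) *: tr_dbar t k s }.

Record hessian_ok (zeta kH : R) (S : nat) t : Prop := {
  hess_sym : forall k s, (s < S)%N -> (tr_H t k s)^T = tr_H t k s ;
  hess_bounded : forall k s u, (s < S)%N ->
    norm2 (tr_H t k s *m u) <= kH * norm2 u ;
  hess_curv : forall k s u, (s < S)%N -> tr_J t k s *m u = 0 ->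
    zeta * norm2 u ^+ 2 <= dot u (tr_H t k s *m u) }.

Definition merit_event (sigma taumin : R) (S kt : nat) (T : Type)
    (W : T -> trajectory R n m N) : set T :=
  [set w | forall k s, (kt <= k)%N -> (s < S)%N ->
     tr_taubar (W w) k s = taumin /\
     (taumin%:E <= tr_trial sigma (W w) k s)%E].

Definition phi_inf (X : set 'cV[R]_n) (tau : R) : R :=
  inf [set phi f c x tau | x in X].

End Trajectory.

Section Conditioning.
Context (R : realType) (d : measure_display) (T : measurableType d).

(* Q is P conditioned on the event E. *)
Definition conditioned_on (P Q : probability T R) (E : set T) : Prop :=
  forall A, measurable A -> (Q A = P (A `&` E) * ((fine (P E))^-1)%:E)%E.

Definition sigma_of (Xs : set (T -> R)) : set (set T) :=
  <<s [set A | exists2 X, Xs X & exists2 B, measurable B & X @^-1` B = A] >>.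

(* Z is a version of the conditional expectation E_Q[X | G]. *)
Record is_cond_exp (Q : probability T R) (G : set (set T)) (X Z : T -> R) :
    Prop := {
  ce_integrable : Q.-integrable setT (EFin \o X) ;
  ce_integrable_version : Q.-integrable setT (EFin \o Z) ;
  ce_measurable : forall B, measurable B -> G (Z @^-1` B) ;
  ce_integral : forall A, G A ->
    (\int[Q]_(w in A) (X w)%:E = \int[Q]_(w in A) (Z w)%:E)%E }.

Definition cond_exp_le (Q : probability T R) (G : set (set T)) (X Y : T -> R) :
    Prop :=
  exists2 Z, is_cond_exp Q G X Z & {ae Q, forall w, Z w <= Y w}.

Context (n m N : nat) (W : T -> trajectory R n m N).

Record random_run (S : nat) : Prop := {
  rr_x : forall k s i, (s < S)%N ->
    measurable_fun setT (fun w => tr_x (W w) k s i 0) ;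
  rr_H : forall k s i j, (s < S)%N ->
    measurable_fun setT (fun w => tr_H (W w) k s i j) ;
  rr_batch : forall k s (B : {set 'I_N}), (s < S)%N ->
    measurable [set w | tr_batch (W w) k s = B] }.

(* What E_{k,s} conditions on.  H_{k,s} belongs to the data fixed when x_{k,s}
   is reached, before and independently of the draw of bar g_{k,s}; this is
   what makes d_{k,s} non-random under E_{k,s}. *)
Definition reached (k s : nat) : set (set T) :=
  sigma_of [set X | [\/ exists i, X = (fun w => tr_x (W w) k 0 i 0),
                        exists i, X = (fun w => tr_x (W w) k s i 0) |
                        exists i j, X = (fun w => tr_H (W w) k s i j)]].

Record gradient_estimates (Q : probability T R) (f : 'I_N -> 'cV[R]_n -> R)
    (L : R) (b S : nat) : Prop := {
  ge_gtilde : forall k s i, (s < S)%N ->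
    is_cond_exp Q (reached k s)
      (fun w => tr_gtilde f b (W w) k s i 0) (fun w => tr_g f (W w) k s i 0) ;
  ge_gbar : forall k s i, (s < S)%N ->
    is_cond_exp Q (reached k s)
      (fun w => tr_gbar f b (W w) k s i 0) (fun w => tr_g f (W w) k s i 0) ;
  ge_var : forall k s, (s < S)%N ->
    cond_exp_le Q (reached k s)
      (fun w => norm2 (tr_gbar f b (W w) k s - tr_g f (W w) k s) ^+ 2)
      (fun w => tr_M L b (W w) k s) }.

End Conditioning.

(* Main.v *)
(** Only total expectations are needed, because all the weights in the descent
    inequality are deterministic.  Write delta for the gradient error
    [gbar - g] and w for the tangential SQP step (right-hand side [(g, 0)]).
    The Lipschitz descent lemma and the adaptive step size rule give a pathwise
    bound of the merit function in terms of the true and the stochastic model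
    reductions, and the KKT systems give
      gbar . dbar >= g . d + (d + w) . delta - |delta|^2 / zeta.
    Since d and w are bounded and known when x_{k,s} is reached, the linear
    term in delta has zero mean, and |delta|^2 is controlled by the variance
    bound L^2/b |x_{k,s} - x_{k,0}|^2.  With the weights lambda_s, the Lyapunov
    function phi(x_{k,s}) + lambda_s |x_{k,s} - x_{k,0}|^2 then decreases in
    mean by Lambda_s times the mean model reduction; as lambda_S = 0 the sum
    telescopes over inner and outer iterations.  The bound on S keeps the
    amplification factor of the backward recursion below 1 + 1/S, so that
    lambda_s <= e p / z with p its constant term, which makes all negative terms
    of Lambda_s of order mu_1 beta. *)
Require Import Defs.
From HB Require Import structures.
From mathcomp Require Import all_boot all_order all_algebra.
From mathcomp Require Import all_classical all_reals all_analysis.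
From mathcomp Require Import measurable_realfun ring lra zify.

Import Order.TTheory GRing.Theory Num.Theory.
Import numFieldNormedType.Exports.

Local Open Scope classical_set_scope.
Local Open Scope ring_scope.

Set Implicit Arguments.
Unset Strict Implicit.

(** * Euclidean norms and perturbation of the SQP subproblem *)

Section Euclidean.
Context {R : realType}.

Lemma dotE n (u v : 'cV[R]_n) : dot u v = (u^T *m v) 0 0.
Proof. by rewrite /dot mxE; apply: eq_bigr => i _; rewrite mxE. Qed.

Lemma dotC n (u v : 'cV[R]_n) : dot u v = dot v u.
Proof. by rewrite /dot; apply: eq_bigr => i _; rewrite mulrC. Qed.

Lemma dotDr n (u v w : 'cV[R]_n) : dot u (v + w) = dot u v + dot u w.
Proof. by rewrite !dotE mulmxDr mxE. Qed.

Lemma dotDl n (u v w : 'cV[R]_n) : dot (u + v) w = dot u w + dot v w.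
Proof. by rewrite dotC dotDr dotC [dot w v]dotC. Qed.

Lemma dotZr n (a : R) (u v : 'cV[R]_n) : dot u (a *: v) = a * dot u v.
Proof. by rewrite !dotE -scalemxAr mxE. Qed.

Lemma dotZl n (a : R) (u v : 'cV[R]_n) : dot (a *: u) v = a * dot u v.
Proof. by rewrite dotC dotZr dotC. Qed.

Lemma dotNr n (u v : 'cV[R]_n) : dot u (- v) = - dot u v.
Proof. by rewrite -scaleN1r dotZr mulN1r. Qed.

Lemma dotNl n (u v : 'cV[R]_n) : dot (- u) v = - dot u v.
Proof. by rewrite dotC dotNr dotC. Qed.

Lemma dotBr n (u v w : 'cV[R]_n) : dot u (v - w) = dot u v - dot u w.
Proof. by rewrite dotDr dotNr. Qed.

Lemma dotBl n (u v w : 'cV[R]_n) : dot (u - v) w = dot u w - dot v w.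
Proof. by rewrite dotDl dotNl. Qed.

Lemma dot0r n (u : 'cV[R]_n) : dot u 0 = 0.
Proof. by rewrite dotE mulmx0 mxE. Qed.

Lemma dot0l n (u : 'cV[R]_n) : dot 0 u = 0.
Proof. by rewrite dotC dot0r. Qed.

Lemma dot_mulmxr n m (A : 'M[R]_(m, n)) (u : 'cV[R]_m) (v : 'cV[R]_n) :
  dot u (A *m v) = dot (A^T *m u) v.
Proof. by rewrite !dotE trmx_mul trmxK mulmxA. Qed.

Lemma dot_ge0 n (u : 'cV[R]_n) : 0 <= dot u u.
Proof. by apply: sumr_ge0 => i _; rewrite -expr2 sqr_ge0. Qed.

Lemma dot_eq0 n (u : 'cV[R]_n) : dot u u = 0 -> u = 0.
Proof.
move=> /eqP; rewrite psumr_eq0 => [/allP u0|i _]; last by rewrite -expr2 sqr_ge0.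
apply/matrixP => i j; rewrite (ord1 j) mxE.
by have := u0 i (mem_index_enum i); rewrite -expr2 sqrf_eq0 => /eqP.
Qed.

Lemma norm2_ge0 n (u : 'cV[R]_n) : 0 <= norm2 u.
Proof. exact: sqrtr_ge0. Qed.

Lemma sqr_norm2 n (u : 'cV[R]_n) : norm2 u ^+ 2 = dot u u.
Proof. by rewrite sqr_sqrtr ?dot_ge0. Qed.

Lemma norm2_0 n : norm2 (0 : 'cV[R]_n) = 0.
Proof. by rewrite /norm2 dot0r sqrtr0. Qed.

Lemma norm2Z n (a : R) (u : 'cV[R]_n) : 0 <= a -> norm2 (a *: u) = a * norm2 u.
Proof.
by move=> a0; rewrite /norm2 dotZl dotZr mulrA sqrtrM ?mulr_ge0// -expr2 sqrtr_sqr ger0_norm.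
Qed.

Lemma norm2N n (u : 'cV[R]_n) : norm2 (- u) = norm2 u.
Proof. by rewrite /norm2 dotNl dotNr opprK. Qed.

Lemma norm2_eq0 n (u : 'cV[R]_n) : norm2 u = 0 -> u = 0.
Proof. by move=> u0; apply: dot_eq0; rewrite -sqr_norm2 u0 expr0n. Qed.

(** Expand the nonnegative square of [norm2 v *: u - norm2 u *: v] and divide by the product of the
    norms. *)
Lemma dot_le_norm2 n (u v : 'cV[R]_n) : dot u v <= norm2 u * norm2 v.
Proof.
have [v0|v0] := eqVneq v 0; first by rewrite v0 dot0r norm2_0 mulr0.
have [u0|u0] := eqVneq u 0; first by rewrite u0 dot0l norm2_0 mul0r.
have norm2_gt0 (x : 'cV[R]_n) : x != 0 -> 0 < norm2 x.
  move=> x0; rewrite lt_neqAle norm2_ge0 andbT eq_sym.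
  by apply: contra x0 => /eqP/norm2_eq0 ->.
have := norm2_gt0 _ u0; have := norm2_gt0 _ v0.
have := dot_ge0 (norm2 v *: u - norm2 u *: v).
rewrite dotBl !dotBr !dotZl !dotZr -!sqr_norm2 [dot v u]dotC.
move: (norm2 u) (norm2 v) (dot u v) => a b c b0 a0 h.
have ab : 0 < a * b by rewrite mulr_gt0.
rewrite -subr_ge0 -(pmulr_rge0 _ ab); nra.
Qed.

Lemma norm1_ge0 n (u : 'cV[R]_n) : 0 <= norm1 u.
Proof. by apply: sumr_ge0 => i _. Qed.

Lemma normr_le_norm2 n (u : 'cV[R]_n) i : `|u i 0| <= norm2 u.
Proof.
rewrite /norm2 -sqrtr_sqr; apply: ler_wsqrtr.
rewrite /dot (bigD1 i)//= -expr2 lerDl; apply: sumr_ge0 => j _.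
by rewrite -expr2 sqr_ge0.
Qed.

(** Young's inequality on the cross term, from the square of [z *: u - v]; [z] trades growth of the
    old distance against the cost of the increment. *)
Lemma sqr_norm2D_le n (z : R) (u v : 'cV[R]_n) : 0 < z ->
  norm2 (u + v) ^+ 2 <= (1 + z) * norm2 u ^+ 2 + (1 + z) / z * norm2 v ^+ 2.
Proof.
move=> z0; rewrite !sqr_norm2.
have := dot_ge0 (z *: u - v).
rewrite dotBl !dotBr !dotZl !dotZr dotDl !dotDr [dot v u]dotC => h.
rewrite -(ler_pM2l z0).
have -> : z * ((1 + z) * dot u u + (1 + z) / z * dot v v)
   = z * (1 + z) * dot u u + (1 + z) * dot v v by field; rewrite gt_eqF.
lra.
Qed.

End Euclidean.

(** * KKT systems: uniqueness, perturbation and explicit solution *)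

Section KKT.
Context {R : realType} {n m : nat}.
Variables (H : 'M[R]_n) (J : 'M[R]_(m, n)) (zeta : R).
Hypothesis zeta_gt0 : 0 < zeta.
Hypothesis H_sym : H^T = H.
Hypothesis H_curv : forall u : 'cV[R]_n, J *m u = 0 ->
  zeta * norm2 u ^+ 2 <= dot u (H *m u).

(** Pairing the first equation with [u] removes the multiplier, because [u] lies in the kernel of
    [J]; the curvature of [H] there and Cauchy-Schwarz give the rest. *)
Lemma kkt_norm2_le (u e : 'cV[R]_n) (v : 'cV[R]_m) :
  H *m u + J^T *m v = - e -> J *m u = 0 ->
  zeta * norm2 u <= norm2 e /\ - dot e u <= norm2 e ^+ 2 / zeta.
Proof.
move=> He Ju.
have eu : dot u (H *m u) = - dot e u.
  have : dot u (H *m u + J^T *m v) = - dot e u by rewrite He dotNr dotC.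
  by rewrite dotDr [X in _ + X = _]dot_mulmxr trmxK Ju dot0l addr0.
have cu := H_curv Ju; rewrite eu in cu.
have cs : - dot e u <= norm2 e * norm2 u.
  by rewrite -dotNl -(norm2N e); exact: dot_le_norm2.
have un : zeta * norm2 u <= norm2 e.
  have := norm2_ge0 u; have := norm2_ge0 e.
  move: (norm2 u) (norm2 e) cu cs => a b cu cs b0.
  rewrite le_eqVlt => /predU1P[<-|a0]; first by rewrite mulr0.
  by rewrite -(ler_pM2r a0); apply: le_trans (le_trans cu cs); rewrite expr2 mulrA.
split => //; apply: (le_trans cs); rewrite ler_pdivlMr// expr2 -mulrA.
by rewrite ler_wpM2l ?norm2_ge0// mulrC.
Qed.

Lemma kkt_uniq (g : 'cV[R]_n) (c : 'cV[R]_m) d y d' y' :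
  sqp_system H J g c d y -> sqp_system H J g c d' y' -> d = d'.
Proof.
move=> [h1 h2] [h1' h2'].
have [] := @kkt_norm2_le (d - d') 0 (y - y').
- by rewrite !mulmxBr addrACA -opprD h1 h1' subrr oppr0.
- by rewrite mulmxBr h2 h2' subrr.
rewrite norm2_0 pmulr_rle0// => h _; apply/eqP; rewrite -subr_eq0; apply/eqP.
by apply: norm2_eq0; apply/eqP; rewrite eq_le h norm2_ge0.
Qed.

Section Perturbation.
Variables (g gb : 'cV[R]_n) (c : 'cV[R]_m).
Variables (d db : 'cV[R]_n) (y yb : 'cV[R]_m).
Hypothesis sys : sqp_system H J g c d y.
Hypothesis sysb : sqp_system H J gb c db yb.

Let diff_eq : H *m (db - d) + J^T *m (yb - y) = - (gb - g).
Proof.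
by rewrite !mulmxBr addrACA -opprD sysb.1 sys.1 opprK addrC opprB.
Qed.

Let J_diff : J *m (db - d) = 0.
Proof. by rewrite mulmxBr sys.2 sysb.2 subrr. Qed.

(** The right-hand side [c'] is free because [db - d] lies in the kernel of [J] whatever [w] is; the
    identity is used for the full step [d] and for the tangential step. *)
Let dot_tangent (w : 'cV[R]_n) c' (yw : 'cV[R]_m) : sqp_system H J g c' w yw ->
  dot g (db - d) = - dot w (H *m (db - d)).
Proof.
move=> [sw _]; rewrite -[g]opprK -sw dotNl dotDl -[in X in X + _]H_sym -dot_mulmxr.
by rewrite -dot_mulmxr J_diff dot0r addr0.
Qed.

Lemma kkt_dot_diff_le (kH : R) :
  (forall u, norm2 (H *m u) <= kH * norm2 u) ->
  dot g (db - d) <= kH * norm2 d * norm2 (db - d).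
Proof.
move=> Hb; rewrite (dot_tangent sys) -dotNl.
apply: le_trans (dot_le_norm2 _ _) _; rewrite norm2N -mulrA mulrCA ler_wpM2l ?norm2_ge0//.
Qed.

(* [w] is the tangential step: it makes the error term linear in [gb - g]. *)
Lemma kkt_dot_lower (w : 'cV[R]_n) (yw : 'cV[R]_m) :
  sqp_system H J g 0 w yw ->
  dot g d + dot (d + w) (gb - g) - norm2 (gb - g) ^+ 2 / zeta <= dot gb db.
Proof.
move=> sw; have [_ h] := kkt_norm2_le diff_eq J_diff.
(* Since [J *m w = 0], the multiplier difference drops out and the [H]-term becomes exactly the
   gradient error. *)
have e1 : dot g (db - d) = dot w (gb - g).
  rewrite (dot_tangent sw).
  have -> : H *m (db - d) = - (gb - g) - J^T *m (yb - y) by rewrite -diff_eq addrK.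
  have w0 : dot w (J^T *m (yb - y)) = 0 by rewrite dot_mulmxr trmxK sw.2 oppr0 dot0l.
  by rewrite [in LHS]dotDr !dotNr w0 subr0 opprK.
(* Of the four terms only the last is quadratic in the perturbation; [h] bounds it from below. *)
have -> : dot gb db = dot g d + dot g (db - d) + dot d (gb - g) + dot (gb - g) (db - d).
  rewrite !(dotBl, dotBr) [dot d gb]dotC [dot d g]dotC; lra.
rewrite e1 dotDl; lra.
Qed.

End Perturbation.

Definition kkt_matrix : 'M[R]_(n + m) := block_mx H J^T J 0.

(** An explicit formula, used to show that the step is measurable with respect to its data. *)
Definition kkt_step (g : 'cV[R]_n) (c : 'cV[R]_m) : 'cV[R]_n :=
  - usubmx (invmx kkt_matrix *m col_mx g c).

Hypothesis J_full : forall y : 'cV[R]_m, J^T *m y = 0 -> y = 0.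

(** A null vector solves the homogeneous system, so its primal part vanishes by uniqueness and its
    dual part by injectivity of [J^T]. *)
Lemma kkt_unit : kkt_matrix \in unitmx.
Proof.
rewrite -row_free_unit; apply: inj_row_free => v vK.
have Kv : kkt_matrix *m v^T = 0.
  apply: trmx_inj; rewrite trmx_mul trmxK tr_block_mx H_sym trmxK trmx0.
  by rewrite -[in X in block_mx _ X _ _]/(J^T) vK trmx0.
apply: trmx_inj; rewrite trmx0; move: Kv; rewrite -[v^T]vsubmxK.
rewrite mul_block_col mul0mx addr0 => /(congr1 (fun A => (usubmx A, dsubmx A))).
rewrite !col_mxKu !col_mxKd !linear0 => -[h1 h2].
have u0 : usubmx v^T = 0.
  by apply: (@kkt_uniq 0 0 _ (dsubmx v^T) _ 0); split; rewrite ?mulmx0 ?addr0 ?oppr0.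
have d0 : dsubmx v^T = 0 by apply: J_full; rewrite u0 mulmx0 add0r in h1.
by rewrite u0 d0 col_mx0.
Qed.

Lemma kkt_stepP (g : 'cV[R]_n) (c : 'cV[R]_m) :
  exists y, sqp_system H J g c (kkt_step g c) y.
Proof.
exists (- dsubmx (invmx kkt_matrix *m col_mx g c)).
have := mulKVmx kkt_unit (col_mx g c).
rewrite -[X in _ *m X]vsubmxK mul_block_col mul0mx addr0.
move=> /eq_col_mx[h1 h2].
by split; rewrite !mulmxN -?opprD ?h1 ?h2.
Qed.

End KKT.

(** For a nonzero [y] with [J^T *m y = 0], the row [y^T] would be an eigenvector of [J *m J^T] for
    the eigenvalue 0, making 0 a singular value. *)
Lemma singular_full (R : realType) n m (J : 'M[R]_(m, n)) (smin : R) :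
  0 < smin -> (forall s, singular_value J s -> smin <= s) ->
  forall y : 'cV[R]_m, J^T *m y = 0 -> y = 0.
Proof.
move=> s0 hs y Jy; apply/eqP/negPn/negP => y0.
have : smin <= 0.
  apply: hs; split => //; apply/eigenvalueP; exists y^T.
    apply: trmx_inj; rewrite !trmx_mul !trmxK -mulmxA Jy mulmx0.
    by rewrite expr0n /= scale0r trmx0.
  by apply: contra y0 => /eqP h; apply/eqP/trmx_inj; rewrite h trmx0.
by rewrite leNgt s0.
Qed.

(** * Descent of the merit function along one step *)

Section Descent.
Context {R : realType} {n : nat}.
Implicit Types (F : 'cV[R]_n -> R) (X : set 'cV[R]_n).

Lemma dot_grad F (x v : 'cV[R]_n) : differentiable F x -> 'd F x v = dot (grad F x) v.
Proof.
move=> dF; rewrite [v in LHS]matrix_sum_delta linear_sum /dot; apply: eq_bigr => i _.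
by rewrite big_ord1 linearZ /= mxE mulrC.
Qed.

Lemma convex_segment X (x v : 'cV[R]_n) (t : R) :
  convex_set (X : set (convex_lmodType 'cV[R]_n)) ->
  X x -> X (x + v) -> 0 <= t -> t <= 1 -> X (x + t *: v).
Proof.
move=> cX Xx Xv t0 t1.
have := cX (x + v) x (Itv01 t0 t1) (mem_set Xv) (mem_set Xx).
move/set_mem; congr X; change (t *: (x + v) + (1 - t) *: x = x + t *: v).
by rewrite scalerDr scalerBl scale1r addrC addrA subrK.
Qed.

(** The mean value theorem is applied to [h], which is, up to a constant, the gap between [F] and
    its quadratic upper model along the segment; the Lipschitz condition makes its derivative
    nonpositive. [G] is kept apart from [grad F] so that the lemma also serves [- F]. *)
Lemma lipschitz_grad_upper F G X (K : R) (x v : 'cV[R]_n) :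
  convex_set (X : set (convex_lmodType 'cV[R]_n)) ->
  (forall y, X y -> differentiable F y) ->
  (forall y (u : 'cV[R]_n), X y -> 'd F y u = dot (G y) u) ->
  lipschitz2_on K X G -> X x -> X (x + v) ->
  F (x + v) <= F x + dot (G x) v + K / 2 * norm2 v ^+ 2.
Proof.
move=> cX dF dFG lG Xx Xv.
have seg (t : R) : 0 <= t -> t <= 1 -> X (x + t *: v) by exact: convex_segment.
pose h (t : R) := F (x + t *: v) - t * dot (G x) v - K / 2 * norm2 v ^+ 2 * t ^+ 2.
pose dh (t : R) := dot (G (x + t *: v)) v - dot (G x) v - K * norm2 v ^+ 2 * t.
have hder (t : R) : t \in `[0, 1]%R -> is_derive t 1 h (dh t).
  rewrite in_itv /= => /andP[t0 t1].
  have Xt := seg _ t0 t1.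
  have Fd : is_derive t 1 (fun s : R => F (x + s *: v)) (dot (G (x + t *: v)) v).
    have eqq : (fun s => s^-1 *: (((fun s : R => F (x + s *: v)) \o shift t) (s *: 1)
               - F (x + t *: v)))
      = (fun s => s^-1 *: ((F \o shift (x + t *: v)) (s *: v) - F (x + t *: v))).
      apply/funext => s /=; congr (_ *: (F _ - _)).
      by rewrite [s *: 1]mulr1 scalerDl addrCA.
    have dd := @diff_derivable _ _ _ F (x + t *: v) v (dF _ Xt).
    split; first by rewrite /derivable eqq.
    by rewrite -dFG// -deriveE; [rewrite /derive eqq | exact: dF].
  rewrite /h /dh; apply: is_derive_eq.
  rewrite scaler0 add0r; move: (dot _ _) (dot _ _) (norm2 _) => b a q.
  change (a - b * 1 - K / 2 * q ^+ 2 * (t * 1 + t * 1) = a - b - K * q ^+ 2 * t).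
  rewrite !mulr1 -mulr2n -[t *+ 2]mulr_natl; congr (_ - _).
  by rewrite mulrA [K / 2 * _]mulrAC divfK ?pnatr_eq0.
have hder' (t : R) : t \in `]0, 1[%R -> is_derive t 1 h (dh t).
  by rewrite in_itv => /andP[t0 t1]; apply: hder; rewrite in_itv /= !ltW.
have hcont : {within `[0, 1], continuous h}.
  by apply: derivable_within_continuous => t /hder[].
have [c c01] := MVT ltr01 hder' hcont.
rewrite subr0 mulr1 /h expr0n /= !mulr0 mul0r !subr0 scale0r addr0 scale1r expr1n mul1r mulr1.
move=> hc; have dc : dh c <= 0.
  move: c01; rewrite in_itv /= => /andP[/ltW c0 /ltW c1].
  rewrite /dh -dotBl subr_le0; apply: le_trans (dot_le_norm2 _ _) _.
  have := lG _ _ (seg _ c0 c1) Xx; rewrite addrAC subrr add0r norm2Z// => h1.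
  have -> : K * norm2 v ^+ 2 * c = K * (c * norm2 v) * norm2 v by ring.
  by rewrite ler_wpM2r ?norm2_ge0.
lra.
Qed.

Lemma lipschitz_grad_bound F X (K : R) (x v : 'cV[R]_n) :
  convex_set (X : set (convex_lmodType 'cV[R]_n)) ->
  (forall y, X y -> differentiable F y) ->
  lipschitz2_on K X (grad F) -> X x -> X (x + v) ->
  `|F (x + v) - F x - dot (grad F x) v| <= K / 2 * norm2 v ^+ 2.
Proof.
move=> cX dF lF Xx Xv; rewrite ler_norml; apply/andP; split.
  have dFN (y : 'cV[R]_n) : X y -> differentiable (- F) y.
    by move=> Xy; exact/differentiableN/dF.
  have gFN (y u : 'cV[R]_n) : X y -> 'd (- F) y u = dot (- grad F y) u.
    by move=> Xy; rewrite diffN ?dotNl -?dot_grad //; exact: dF.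
  have lFN : lipschitz2_on K X (fun y => - grad F y).
    by move=> y u Xy Xu; rewrite -opprD norm2N; exact: lF.
  have h : - F (x + v) <= - F x + dot (- grad F x) v + K / 2 * norm2 v ^+ 2.
    exact: (lipschitz_grad_upper cX dFN gFN lFN Xx Xv).
  rewrite dotNl in h; move: h; move: (norm2 v ^+ 2) (dot _ _) (F x) (F (x + v)) => q a b e h.
  lra.
have gF (y u : 'cV[R]_n) : X y -> 'd F y u = dot (grad F y) u.
  by move=> Xy; exact/dot_grad/dF.
have := lipschitz_grad_upper cX dF gF lF Xx Xv.
lra.
Qed.

End Descent.

(** * Upper model of the merit function and the adaptive step size *)

Section MeritDescent.
Context {R : realType} {n m N : nat}.
Variables (X : set 'cV[R]_n) (f : 'I_N -> 'cV[R]_n -> R) (c : 'cV[R]_n -> 'cV[R]_m).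
Variables (L : R) (gam : 'I_m -> R).
Hypothesis prob : smooth_problem X f c L gam.
Let Gam := \sum_(i < m) gam i.

Lemma favgE : favg f = N%:R^-1 *: (\sum_(i < N) f i).
Proof. by apply/funext => x; rewrite /favg fct_sumE. Qed.

Lemma differentiable_favg x : X x -> differentiable (favg f) x.
Proof.
move=> Xx; rewrite favgE; apply/differentiableZ.
by apply: differentiable_sum => i; exact: sp_fi_diff prob i x Xx.
Qed.

Lemma dot_grad_favg (x v : 'cV[R]_n) : X x ->
  dot (grad (favg f) x) v = N%:R^-1 * \sum_(i < N) dot (grad (f i) x) v.
Proof.
move=> Xx; rewrite -[LHS](dot_grad v (differentiable_favg Xx)).
have df i := sp_fi_diff prob i Xx.
rewrite -deriveE; last exact: differentiable_favg.
rewrite favgE deriveZ; last by apply/diff_derivable/differentiable_sum.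
rewrite derive_sum; last by move=> i; exact/diff_derivable.
congr (_ * _); apply: eq_bigr => i _.
by rewrite deriveE// dot_grad.
Qed.

Lemma favg_upper (x v : 'cV[R]_n) : (0 < N)%N -> X x -> X (x + v) ->
  favg f (x + v) <= favg f x + dot (grad (favg f) x) v + L / 2 * norm2 v ^+ 2.
Proof.
move=> N0 Xx Xv; rewrite dot_grad_favg// /favg -mulrDr -big_split /=.
have NR : 0 < N%:R :> R by rewrite ltr0n.
rewrite mulrC ler_pdivrMr// mulrDl [N%:R^-1 * _]mulrC divfK ?gt_eqF//.
apply: (@le_trans _ _ (\sum_(i < N) (f i x + dot (grad (f i) x) v + L / 2 * norm2 v ^+ 2))).
  apply: ler_sum => i _.
  have := lipschitz_grad_bound (sp_convex prob) (sp_fi_diff prob i) (sp_fi_lip prob i) Xx Xv.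
  move=> /(le_trans (ler_norm _)); lra.
by rewrite big_split /= sumr_const card_ord mulr_natr.
Qed.

(** As [jac c x *m d = - c x], the linearization of each component at [x + a *: d] is
    [(1 - a) * c x i 0]; only the quadratic remainders are added. *)
Lemma norm1_c_upper (x d : 'cV[R]_n) (a : R) : 0 <= a ->
  X x -> X (x + a *: d) -> jac c x *m d = - c x ->
  norm1 (c (x + a *: d)) <= `|1 - a| * norm1 (c x) + Gam / 2 * a ^+ 2 * norm2 d ^+ 2.
Proof.
move=> a0 Xx Xv Jd; rewrite /norm1 mulr_sumr /Gam !mulr_suml -big_split /=.
apply: ler_sum => i _.
have := lipschitz_grad_bound (sp_convex prob) (sp_ci_diff prob i) (sp_ci_lip prob i) Xx Xv.
have -> : dot (grad (coordf c i) x) (a *: d) = - a * c x i 0.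
  rewrite dotZr mulNr -mulrN; congr (_ * _).
  have := congr1 (fun M : 'cV[R]_m => M i 0) Jd; rewrite !mxE => <-.
  by rewrite /dot; apply: eq_bigr => j _; rewrite [jac _ _ _ _]mxE.
rewrite norm2Z// exprMn /coordf => h.
have -> : c (x + a *: d) i 0
  = (1 - a) * c x i 0 + (c (x + a *: d) i 0 - c x i 0 - - a * c x i 0) by ring.
apply: le_trans (ler_normD _ _) _; rewrite normrM lerD2l.
by rewrite -mulrA.
Qed.

Lemma phi_upper (tau : R) (x d : 'cV[R]_n) (a : R) : (0 < N)%N -> 0 <= tau ->
  0 <= a -> X x -> X (x + a *: d) -> jac c x *m d = - c x ->
  phi f c (x + a *: d) tau <= tau * favg f x + tau * a * dot (grad (favg f) x) d
    + `|1 - a| * norm1 (c x) + (tau * L + Gam) / 2 * a ^+ 2 * norm2 d ^+ 2.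
Proof.
move=> N0 tau0 a0 Xx Xv Jd; rewrite /phi.
have := favg_upper N0 Xx Xv; rewrite dotZr norm2Z// exprMn => /(ler_wpM2l tau0).
have := norm1_c_upper a0 Xx Xv Jd.
lra.
Qed.

Section Step.
Variables (tau au beta kl : R).
Hypothesis (N_gt0 : (0 < N)%N) (tau_gt0 : 0 < tau) (L_gt0 : 0 < L).
Hypothesis (Gam_ge0 : 0 <= Gam) (beta_gt0 : 0 < beta) (kl_gt0 : 0 < kl).
Let A := tau * L + Gam.
Let al := kl * tau / A.
Hypothesis (al_au : al < au) (alb_le1 : al * beta <= 1).
Variables (x db gb : 'cV[R]_n).
Let a := adaptive_step L Gam au beta (c x) tau gb db.
Let Dl := dl (c x) tau gb db.
Hypothesis db_neq0 : db != 0.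
Hypothesis Dl_ge : kl * tau * norm2 db ^+ 2 <= Dl.

Let A_gt0 : 0 < A.
Proof. by rewrite /A ltr_wpDr// mulr_gt0. Qed.

Let n_gt0 : 0 < norm2 db ^+ 2.
Proof.
rewrite exprn_gt0// lt_neqAle norm2_ge0 andbT eq_sym.
by apply: contra db_neq0 => /eqP/norm2_eq0 ->.
Qed.

(** In all three cases of the rule the step is at most [ah], so the model reduction pays for the
    quadratic term. A step beyond 1 makes [1 - a] negative; the extra multiple of [norm1 (c x)] is
    then covered by the correction subtracted in [at_]. *)
Lemma adaptive_step_spec :
  [/\ al * beta <= a, a <= au * beta &
      `|1 - a| * norm1 (c x) + A / 2 * a ^+ 2 * norm2 db ^+ 2
        <= (1 - a) * norm1 (c x) + 2^-1 * a * beta * Dl].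
Proof.
rewrite /a /adaptive_step -/A -/Dl.
have den0 : 0 < A * norm2 db ^+ 2 by rewrite mulr_gt0.
have cn0 := norm1_ge0 (c x).
set ah := Num.min _ au * beta.
have ah_lo : al * beta <= ah.
  rewrite /ah ler_wpM2r ?(ltW beta_gt0)// le_min (ltW al_au) andbT.
  by rewrite ler_pdivlMr// /al mulrA divfK ?gt_eqF.
have ah_hi : ah <= au * beta by rewrite /ah ler_wpM2r ?(ltW beta_gt0)// ge_min lexx orbT.
have ah_D : ah * (A * norm2 db ^+ 2) <= beta * Dl.
  rewrite /ah mulrAC [leRHS]mulrC ler_wpM2r ?(ltW beta_gt0)//.
  by rewrite -ler_pdivlMr// ge_min lexx.
have al_gt0 : 0 < al by rewrite /al !mulr_gt0 ?invr_gt0.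
have ah0 : 0 < ah by apply: lt_le_trans ah_lo; rewrite mulr_gt0.
have key (s : R) : 0 <= s -> s <= ah ->
    A / 2 * s ^+ 2 * norm2 db ^+ 2 <= 2^-1 * s * beta * Dl.
  move=> s0 sa; have h : s * (A * norm2 db ^+ 2) <= beta * Dl.
    by apply: le_trans ah_D; rewrite ler_wpM2r// ltW.
  have := ler_wpM2l s0 h; rewrite expr2; lra.
case: ifPn => [ah1|]; last rewrite -leNgt => ah1.
  split => //; rewrite ger0_norm ?subr_ge0 ?(ltW ah1)//.
  by rewrite lerD2l; apply: key => //; exact: ltW.
case: ifPn => [_|].
  split => //; first exact: le_trans ah1 ah_hi.
  by rewrite subrr normr0 lerD2l; exact: key.
rewrite -ltNge; set at_ := ah - _ => at1.
have hat : at_ <= ah by rewrite /at_ lerBlDr lerDl divr_ge0 ?(ltW den0)// mulr_ge0.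
(* The lower bound comes from [al * beta <= 1], as the step exceeds 1 here. *)
split; [by apply: le_trans alb_le1 (ltW at1)|exact: le_trans hat ah_hi|].
rewrite ltr0_norm ?subr_lt0// opprB.
(* Half of [at_] times the correction is [2 * at_ * norm1 (c x)], at least the sign change
   [2 * (at_ - 1) * norm1 (c x)]. *)
have e : at_ * (A * norm2 db ^+ 2) = ah * (A * norm2 db ^+ 2) - 4 * norm1 (c x).
  by rewrite /at_ mulrBl divfK ?gt_eqF.
have at0 : 0 <= at_ by rewrite ltW// (lt_trans _ at1).
have h1 := ler_wpM2l at0 ah_D.
have h2 : at_ * (at_ * (A * norm2 db ^+ 2)) = at_ * (ah * (A * norm2 db ^+ 2)) - at_ * (4 * norm1 (c x)).
  by rewrite e mulrBr.
have h3 : 0 <= at_ * norm1 (c x) by rewrite mulr_ge0.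
rewrite expr2; lra.
Qed.

(** Writing [dot g db] as [dot g d + dot g (db - d)] brings in the true model reduction and leaves a
    bias term. *)
Lemma phi_step (g d : 'cV[R]_n) : g = grad (favg f) x ->
  jac c x *m db = - c x -> X x -> X (x + a *: db) ->
  phi f c (x + a *: db) tau <= phi f c x tau - a * dl (c x) tau g d
    + 2^-1 * a * beta * Dl + a * tau * dot g (db - d).
Proof.
move=> -> Jd Xx Xa; have [alo ahi hs] := adaptive_step_spec.
have a0 : 0 <= a.
  by apply: le_trans alo; rewrite mulr_ge0 ?(ltW beta_gt0)// /al !mulr_ge0 ?invr_ge0 ?ltW.
apply: (le_trans (phi_upper N_gt0 (ltW tau_gt0) a0 Xx Xa Jd)).
move: hs; rewrite /phi /dl dotBr -/A.
lra.
Qed.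

End Step.

End MeritDescent.

(** * The weights lambda_s and Lambda_s *)

Section Constants.
Context {R : realType}.

Lemma expr1D_le_expR (t : R) (k : nat) : 0 <= t -> t * k%:R <= 1 ->
  (1 + t) ^+ k <= expR 1.
Proof.
move=> t0 tk; apply: (@le_trans _ _ (expR t ^+ k)).
  by apply: lerXn2r; rewrite ?nnegrE ?expR_ge0 ?addr_ge0// expR_ge1Dx.
by rewrite -expRM_natr ler_expR.
Qed.

(** * Backward linear recursions *)

Section Backward.
Variables (lam : nat -> R) (S : nat) (p q : R).
Hypotheses (p_ge0 : 0 <= p) (q_ge1 : 1 <= q) (lamS : lam S = 0).
Hypothesis lam_rec : forall s, (s < S)%N -> lam s = lam s.+1 * q + p.

Lemma backward_rec_ge0 s : (s <= S)%N -> 0 <= lam s.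
Proof.
move=> sS; have [j ->] : exists j, s = (S - j)%N by exists (S - s)%N; rewrite subKn.
elim: j => [|j IH]; first by rewrite subn0 lamS.
(* Natural subtraction is truncated, so once [j] reaches [S] the index stays at 0. *)
have [Sj|jS] := leqP S j.
  by move: IH; rewrite (_ : S - j.+1 = S - j)%N //; lia.
have -> : (S - j.+1 = (S - j).-1)%N by lia.
have h : (0 < S - j)%N by lia.
by rewrite lam_rec prednK//; [rewrite addr_ge0// mulr_ge0// (le_trans ler01)|lia].
Qed.

(** By induction on the distance [j] to [S], with bound [p * j * q ^ j]; the new constant [p] is
    absorbed since [q ^ (j + 1) >= 1]. *)
Lemma backward_rec_le s : (s <= S)%N -> lam s <= p * S%:R * q ^+ S.
Proof.
move=> sS; have [j jS ->] : exists2 j, (j <= S)%N & s = (S - j)%N.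
  by exists (S - s)%N; rewrite ?leq_subr// subKn.
have q0 : 0 <= q by exact: le_trans q_ge1.
apply: (@le_trans _ _ (p * j%:R * q ^+ j)).
  elim: j jS => [|j IH] jS; first by rewrite subn0 lamS mulr0 mul0r.
  have h : (0 < S - j)%N by lia.
  have -> : (S - j.+1 = (S - j).-1)%N by lia.
  rewrite lam_rec prednK//; last lia.
  have /(ler_wpM2r q0) := IH (ltnW jS).
  have qj : 1 <= q ^+ j.+1 by rewrite exprn_ege1.
  have /(ler_wpM2l p_ge0) := qj.
  rewrite exprSr in qj *; rewrite -natr1; lra.
rewrite ler_pM ?mulr_ge0 ?exprn_ge0// ?ler_weXn2l//.
by rewrite ler_wpM2l// ler_nat.
Qed.

End Backward.

Variables (A kl tau au L zeta kH kd : R).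
Hypotheses (A_gt0 : 0 < A) (kl_gt0 : 0 < kl) (tau_gt0 : 0 < tau) (au_gt0 : 0 < au).
Hypotheses (L_gt0 : 0 < L) (zeta_gt0 : 0 < zeta) (kH_gt0 : 0 < kH) (kd_gt0 : 0 < kd).
Let al := kl * tau / A.

(* [Lambda_s >= al * beta - Lam_defect * (mu * beta)], see [Lam_lower]. *)
Definition Lam_defect : R :=
  (2^-1 * au + au * kH * kd / (2 * kl)) / A
  + expR 1 * au ^+ 3 * L ^+ 2 * (kH * kd + zeta^-1) * (1 + A) / (2 * kl * A ^+ 3).

Lemma Lam_defect_gt0 : 0 < Lam_defect.
Proof.
rewrite /Lam_defect; apply: addr_gt0.
  by rewrite divr_gt0// addr_gt0 ?mulr_gt0 ?divr_gt0 ?invr_gt0 ?mulr_gt0.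
by rewrite !(divr_gt0, mulr_gt0, addr_gt0, exprn_gt0, invr_gt0, expR_gt0).
Qed.

(** Small enough that the defect takes at most half of [al], and capped by 1; it involves only the
    problem constants, so it is universal. *)
Definition step_mu : R := Num.min 1 (al / (2 * Lam_defect)).

Lemma step_mu_gt0 : 0 < step_mu.
Proof.
have := Lam_defect_gt0 => h.
by rewrite /step_mu lt_min ltr01 /= /al !(divr_gt0, mulr_gt0).
Qed.

Lemma step_mu_le1 : step_mu <= 1.
Proof. by rewrite /step_mu ge_min lexx. Qed.

(** * Bounds on the weights, with [h] for the square root of N^gamma *)

Section LamBound.
Variables (b h : R) (S : nat) (lam : nat -> R).
Let mu := step_mu.
Let beta := mu * b / (A * (h * h)).
Let z := A / h.
Let T3 := mu ^+ 2 * au ^+ 2 * L ^+ 2 * b / (A ^+ 3 * kl * zeta).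
Let T2 := mu ^+ 2 * au ^+ 2 * L ^+ 2 * b / (A ^+ 2 * kl * zeta).
Let q := (1 + z) * (1 + au ^+ 2 * beta ^+ 2 * L ^+ 2 / (kl * z * b * zeta)).
Let p := au * tau * L ^+ 2 / (2 * b) * (kH * kd + beta ^+ 2 / zeta).
Hypotheses (h_ge1 : 1 <= h) (b_ge1 : 1 <= b) (bh : b <= h * h).
Hypotheses (beta_le1 : beta <= 1) (S_le : S%:R <= h / (A + T3 + T2)).
Hypothesis lamS : lam S = 0.
Hypothesis lam_rec : forall s, (s < S)%N -> lam s = lam s.+1 * q + p.

Let h_gt0 : 0 < h. Proof. exact: lt_le_trans ltr01 h_ge1. Qed.
Let b_gt0 : 0 < b. Proof. exact: lt_le_trans ltr01 b_ge1. Qed.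
Let mu_gt0 : 0 < mu. Proof. exact: step_mu_gt0. Qed.
Let beta_gt0 : 0 < beta. Proof. by rewrite /beta divr_gt0// !mulr_gt0. Qed.
Let z_gt0 : 0 < z. Proof. by rewrite /z divr_gt0. Qed.
Let T3_gt0 : 0 < T3. Proof. by rewrite /T3 !(divr_gt0, mulr_gt0, exprn_gt0). Qed.
Let T2_gt0 : 0 < T2. Proof. by rewrite /T2 !(divr_gt0, mulr_gt0, exprn_gt0). Qed.
Let p_gt0 : 0 < p.
Proof. by rewrite /p !(divr_gt0, mulr_gt0, exprn_gt0, addr_gt0). Qed.

Let q_ge1 : 1 <= q.
Proof.
have t0 : 0 <= au ^+ 2 * beta ^+ 2 * L ^+ 2 / (kl * z * b * zeta).
  by rewrite ltW// !(divr_gt0, mulr_gt0, exprn_gt0).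
rewrite /q; move: z_gt0 t0; move: (z) => x; move: (_ / _) => t; nra.
Qed.

Lemma lam_ge0 s : (s <= S)%N -> 0 <= lam s.
Proof. exact: (backward_rec_ge0 (ltW p_gt0) q_ge1 lamS lam_rec). Qed.

(** Exactly, [q = 1 + z + T3 / h ^ 3 + T2 / h ^ 4]. Lowering the powers of [h] to 1, by [h >= 1],
    makes the growth rate the reciprocal of the bound on [S]. *)
Let q_le : q <= 1 + (A + T3 + T2) / h.
Proof.
have e1 : au ^+ 2 * beta ^+ 2 * L ^+ 2 / (kl * z * b * zeta) = T3 / h ^+ 3.
  by rewrite /T3 /z /beta; field; rewrite !gt_eqF.
have e2 : z * (T3 / h ^+ 3) = T2 / h ^+ 4.
  by rewrite /T3 /T2 /z; field; rewrite !gt_eqF.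
have le_div T k : 0 < T -> T / h ^+ k.+1 <= T / h.
  move=> T0; rewrite ler_wpM2l ?(ltW T0)// lef_pV2 ?posrE ?exprn_gt0//.
  by rewrite exprS ler_pMr// exprn_ege1.
rewrite /q e1 mulrDl mul1r mulrDr mulr1 e2.
have := le_div _ 2%N T3_gt0; have := le_div _ 3%N T2_gt0.
rewrite /z; lra.
Qed.

(** The bound on [S] gives both [q ^ S <= e], through the growth rate of [q], and [S <= 1 / z],
    after dropping [T3] and [T2]. *)
Lemma lam_le s : (s <= S)%N -> lam s <= expR 1 * p / z.
Proof.
move=> sS; have := backward_rec_le (ltW p_gt0) q_ge1 lamS lam_rec sS.
have D0 : 0 < A + T3 + T2 by rewrite !addr_gt0.
have Sz : S%:R <= z^-1.
  apply: le_trans S_le _; rewrite /z invf_div ler_wpM2l ?(ltW h_gt0)//.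
  by rewrite lef_pV2 ?posrE// -addrA lerDl addr_ge0 ?ltW.
have qS : q ^+ S <= expR 1.
  apply: (@le_trans _ _ ((1 + (A + T3 + T2) / h) ^+ S)).
    by apply: lerXn2r => //; rewrite ?nnegrE ?(le_trans ler01)// (le_trans q_ge1).
  apply: expr1D_le_expR; first by rewrite ltW// divr_gt0.
  by move: S_le; rewrite ler_pdivlMr// mulrC mulrAC ler_pdivrMr// mul1r mulrC.
have q0 : 0 <= q by exact: le_trans q_ge1.
move=> /le_trans -> //.
rewrite mulrC -[leRHS]mulrA; apply: ler_pM => //; first exact: exprn_ge0.
  exact: mulr_ge0 (ltW p_gt0) _.
by rewrite ler_wpM2l// ltW.
Qed.

(** The negative terms add up to at most [Lam_defect * mu * beta], which the choice of [mu] keeps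
    within half of [al * beta]; the other half is the left-hand side. *)
Lemma Lam_lower s : (s < S)%N ->
  mu * al / 2 * b / (A * (h * h)) <=
  al * beta - 2^-1 * au * beta ^+ 2 - au * kH * kd * beta ^+ 2 / (2 * kl)
  - lam s.+1 * (1 + z) * (au ^+ 2 * beta ^+ 2 / (tau * kl * z)).
Proof.
move=> sS.
have -> : mu * al / 2 * b / (A * (h * h)) = al * beta / 2.
  by rewrite /beta; field; rewrite !gt_eqF.
(* This is where [b <= h * h] enters. *)
have beta_mu : beta <= mu / A.
  rewrite /beta invfM mulrA -[leRHS]mulr1 [X in X <= _](_ : _ = mu / A * (b / (h * h))).
    apply: ler_wpM2l; first by rewrite ltW// divr_gt0.
    by rewrite ler_pdivrMr ?mulr_gt0// mul1r.
  by field; rewrite !gt_eqF.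
have h1 : (2^-1 * au + au * kH * kd / (2 * kl)) * beta ^+ 2
    <= (2^-1 * au + au * kH * kd / (2 * kl)) / A * (mu * beta).
  rewrite -[leRHS]mulrA; apply: ler_wpM2l.
    by rewrite ltW// addr_gt0 ?mulr_gt0 ?divr_gt0 ?invr_gt0 ?mulr_gt0.
  have : beta * beta <= mu / A * beta by rewrite ler_wpM2r// ltW.
  by rewrite expr2 [mu / A]mulrC -[A^-1 * mu * beta]mulrA.
have h2 : lam s.+1 * (1 + z) * (au ^+ 2 * beta ^+ 2 / (tau * kl * z)) <=
   expR 1 * au ^+ 3 * L ^+ 2 * (kH * kd + zeta^-1) * (1 + A) / (2 * kl * A ^+ 3) * (mu * beta).
  (* Insert [lam_le] together with [beta ^ 2 <= 1] and [z <= A]. What remains is an identity: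
     [1 / z ^ 2] cancels the [h * h] in one factor [beta], and [1 / (2 * b)] cancels its [b]. *)
  apply: (@le_trans _ _ (expR 1 * (au * tau * L ^+ 2 / (2 * b) * (kH * kd + zeta^-1)) / z
      * (1 + A) * (au ^+ 2 * beta ^+ 2 / (tau * kl * z)))).
    rewrite ler_wpM2r//; first by rewrite ltW// !(divr_gt0, mulr_gt0, exprn_gt0).
    rewrite ler_pM ?lam_ge0// ?addr_ge0 ?(ltW z_gt0)//.
      apply: le_trans (lam_le sS) _; rewrite ler_wpM2r ?invr_ge0 ?(ltW z_gt0)//.
      rewrite ler_wpM2l ?expR_ge0// /p ler_wpM2l//.
        by rewrite ltW// !(divr_gt0, mulr_gt0, exprn_gt0).
      rewrite lerD2l ler_pdivrMr// mulVf ?gt_eqF// expr_le1// ltW//.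
    rewrite lerD2l /z ler_pdivrMr// ler_peMr// ltW//.
  rewrite le_eqVlt; apply/orP; left; apply/eqP.
  by rewrite /beta /z; field; rewrite !gt_eqF.
have h3 : Lam_defect * (mu * beta) <= al / 2 * beta.
  rewrite mulrA ler_wpM2r ?(ltW beta_gt0)//.
  have D0 := Lam_defect_gt0.
  have : mu <= al / (2 * Lam_defect) by rewrite /mu /step_mu ge_min lexx orbT.
  by rewrite ler_pdivlMr ?mulr_gt0//; lra.
have h4 : Lam_defect * (mu * beta)
   = (2^-1 * au + au * kH * kd / (2 * kl)) / A * (mu * beta)
  + expR 1 * au ^+ 3 * L ^+ 2 * (kH * kd + zeta^-1) * (1 + A) / (2 * kl * A ^+ 3) * (mu * beta).
  by rewrite /Lam_defect mulrDl.
rewrite h4 in h3.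
have h5 : (2^-1 * au + au * kH * kd / (2 * kl)) * beta ^+ 2
  = 2^-1 * au * beta ^+ 2 + au * kH * kd * beta ^+ 2 / (2 * kl) by rewrite mulrDl [_ / _ * _]mulrAC.
rewrite h5 in h1.
by move: (au * kH * kd * beta ^+ 2 / (2 * kl)) (expR 1 * _ * _ * _ * _ / _ * _) (lam s.+1 * _ * _) (2^-1 * au * beta ^+ 2) ((2^-1 * au + _) / A * _) h1 h2 h3 => x1 x2 x3 x4 x5; lra.
Qed.

End LamBound.
End Constants.

(** * Measurability of vector- and matrix-valued maps *)

Section MatrixMeasurability.
Context d (T : measurableType d) {R : realType}.

(** Stated entrywise; [T] may carry the full or a coarser sigma-algebra, and both occur below. *)
Definition measurable_mx p q (M : T -> 'M[R]_(p, q)) : Prop :=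
  forall i j, measurable_fun setT (fun w => M w i j).

Lemma measurable_mulmx p q r (A : T -> 'M[R]_(p, q)) (B : T -> 'M[R]_(q, r)) :
  measurable_mx A -> measurable_mx B -> measurable_mx (fun w => A w *m B w).
Proof.
move=> mA mB i j.
rewrite (_ : (fun w => _) = fun w => \sum_k A w i k * B w k j); last first.
  by apply/funext => w; rewrite mxE.
by apply: measurable_sum => k; exact: measurable_funM.
Qed.

Lemma measurable_addmx p q (A B : T -> 'M[R]_(p, q)) :
  measurable_mx A -> measurable_mx B -> measurable_mx (fun w => A w + B w).
Proof.
move=> mA mB i j.
rewrite (_ : (fun w => _) = fun w => A w i j + B w i j); last first.
  by apply/funext => w; rewrite mxE.
exact: measurable_funD.
Qed.

Lemma measurable_oppmx p q (A : T -> 'M[R]_(p, q)) :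
  measurable_mx A -> measurable_mx (fun w => - A w).
Proof.
move=> mA i j.
rewrite (_ : (fun w => _) = fun w => - A w i j); last first.
  by apply/funext => w; rewrite mxE.
exact: measurable_funN.
Qed.

Lemma measurable_trmx p q (A : T -> 'M[R]_(p, q)) :
  measurable_mx A -> measurable_mx (fun w => (A w)^T).
Proof.
by move=> mA i j; under eq_fun do rewrite mxE; exact: mA.
Qed.

Lemma measurable_block p q r s (A : T -> 'M[R]_(p, r)) (B : T -> 'M[R]_(p, s))
    (C : T -> 'M[R]_(q, r)) (D : T -> 'M[R]_(q, s)) :
  measurable_mx A -> measurable_mx B -> measurable_mx C -> measurable_mx D ->
  measurable_mx (fun w => block_mx (A w) (B w) (C w) (D w)).
Proof.
move=> mA mB mC mD i j.
case: (split_ordP i) => i' ->; case: (split_ordP j) => j' ->.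
- by under eq_fun do rewrite block_mxEul; exact: mA.
- by under eq_fun do rewrite block_mxEur; exact: mB.
- by under eq_fun do rewrite block_mxEdl; exact: mC.
- by under eq_fun do rewrite block_mxEdr; exact: mD.
Qed.

Lemma measurable_det n (A : T -> 'M[R]_n) :
  measurable_mx A -> measurable_fun setT (fun w => \det (A w)).
Proof.
move=> mA; rewrite /determinant; apply: measurable_sum => s.
apply: measurable_funM => //; apply: measurable_prod => i _; exact: mA.
Qed.

(** Inversion is continuous only away from 0, so the composition is taken on that open set. *)
Lemma measurable_inv_neq0 (a : T -> R) : (forall w, a w != 0) ->
  measurable_fun setT a -> measurable_fun setT (fun w => (a w)^-1).
Proof.
move=> a0 ma; have minv : measurable_fun [set x : R | x != 0] (@GRing.inv R).
  apply: open_continuous_measurable_fun.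
    by rewrite openE => x /= x0; near=> y; near: y; exact: open_neq.
  by move=> x /set_mem /= x0; exact: inv_continuous.
apply: (measurable_comp _ _ minv ma) => //.
- apply: open_measurable.
  by rewrite openE => x /= x0; near=> y; near: y; exact: open_neq.
- by move=> _ [w _ <-]; exact: a0.
Unshelve. all: by end_near. Qed.

(** The entries are cofactors over the determinant, both polynomial in the entries of [A]. *)
Lemma measurable_invmx n (A : T -> 'M[R]_n) : (forall w, A w \in unitmx) ->
  measurable_mx A -> measurable_mx (fun w => invmx (A w)).
Proof.
move=> uA mA i j.
rewrite (_ : (fun w => _) = fun w => (\det (A w))^-1 * (\adj (A w)) i j); last first.
  by apply/funext => w; rewrite /invmx uA !mxE.
apply: measurable_funM.
  apply: measurable_inv_neq0; last exact: measurable_det.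
  by move=> w; rewrite -unitfE -unitmxE.
rewrite (_ : (fun w => _) = fun w => (-1) ^+ (j + i) * \det (row' j (col' i (A w)))); last first.
  by apply/funext => w; rewrite mxE.
apply: measurable_funM => //; apply: measurable_det.
by move=> k l; under eq_fun do rewrite !mxE; exact: mA.
Qed.

End MatrixMeasurability.

(** * Random vectors composed with functions continuous on an open set *)

Section VectorComposition.
Context d (T : measurableType d) {R : realType} {n : nat}.
Variable x : T -> 'cV[R]_n.
Hypothesis mx : measurable_mx x.

Lemma measurable_preimage_ball (q : 'cV[R]_n) (e : R) : 0 < e ->
  measurable (x @^-1` ball q e).
Proof.
move=> e0.
rewrite (_ : _ @^-1` _ = \bigcap_(i in [set: 'I_n]) [set w | `|q i 0 - x w i 0| < e]).
  apply: fin_bigcap_measurable => // i _.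
  have m1 : measurable_fun setT (fun w => `|q i 0 - x w i 0|).
    by apply: measurableT_comp => //; apply: measurable_funB.
  have := m1 measurableT _ (measurable_itv `]-oo, e[).
  rewrite setTI; congr measurable; apply/seteqP; split => w /=; rewrite in_itv //=.
apply/seteqP; split => [w /= [_ h] i /= _|w /= h]; first exact: (h i 0).
by split => // i j; rewrite (ord1 j); exact: (h i).
Qed.

(** An open set is a union of balls with rational centres and radii [1 / (k + 1)], of which there
    are countably many. *)
Lemma measurable_preimage_open (O : set 'cV[R]_n) : open O -> measurable (x @^-1` O).
Proof.
move=> oO.
pose qv (q : 'cV[rat]_n) : 'cV[R]_n := map_mx (@ratr R) q.
pose good (p : 'cV[rat]_n * nat) := ball (qv p.1) (p.2.+1%:R^-1) `<=` O.
rewrite (_ : _ @^-1` _ = \bigcup_(p in good) (x @^-1` ball (qv p.1) p.2.+1%:R^-1)); last first.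
  apply/seteqP; split => [w /= Ow|w [p gp] /= ]; last by move=> /gp.
  move: oO; rewrite openE => /(_ _ Ow) /nbhs_ballP[e /= e0 eO].
  (* With radius below [e / 2], a rational centre within that radius of [x w] has its ball inside
     the ball of radius [e] around [x w]. *)
  have [k ke] : exists k : nat, k.+1%:R^-1 < e / 2.
    have [k _ kP] := near_infty_natSinv_lt (PosNum (divr_gt0 e0 (ltr0n R 2))).
    by exists k; apply: kP => /=.
  have k0 : 0 < k.+1%:R^-1 :> R by rewrite invr_gt0.
  have /choice[q hq] : forall i, exists q : rat, `|ratr q - x w i 0| < k.+1%:R^-1.
    move=> i; have [|q] := @rat_in_itvoo R (x w i 0 - k.+1%:R^-1) (x w i 0 + k.+1%:R^-1).
      by rewrite ltrBlDr -addrA ltrDl addr_gt0.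
    by rewrite in_itv /= => hq; exists q; rewrite ltr_distl.
  exists (\col_i q i, k) => /=; last first.
    by split => // i j; rewrite (ord1 j) !mxE; exact: hq.
  move=> y /= [_ hy]; apply: eO; split => // i j; rewrite (ord1 j).
  have := hy i 0; rewrite !mxE => h1; have h2 := hq i.
  rewrite /ball /= in h1 *.
  rewrite (_ : x w i 0 - y i 0 = - (ratr (q i) - x w i 0) + (ratr (q i) - y i 0)); last by ring.
  apply: le_lt_trans (ler_normD _ _) _; rewrite normrN [e]splitr.
  by apply: ltrD; [exact: lt_trans h2 ke|exact: lt_trans h1 ke].
rewrite bigcup_mkcond; apply: countable_bigcupT_measurable => [|p]; first exact: countableP.
case: ifPn => _ //; exact: measurable_preimage_ball.
Qed.

(** Continuity is given on [X] only; intersecting the preimage of an interval with [X] makes it open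
    and loses no [w]. *)
Lemma measurable_continuous_comp (X : set 'cV[R]_n) (F : 'cV[R]_n -> R) : open X ->
  (forall y, X y -> {for y, continuous F}) -> (forall w, X (x w)) ->
  measurable_fun setT (fun w => F (x w)).
Proof.
move=> oX cF Xx; apply: (measurability _ (RGenOpens.measurableE R)).
move=> _ [_ [a [b ->] <-]]; rewrite setTI.
rewrite (_ : _ @^-1` _ = x @^-1` (X `&` F @^-1` `]a, b[%classic)); last first.
  by apply/seteqP; split => w /=; [|case].
apply: measurable_preimage_open; rewrite openE => y [Xy Fy].
apply: filterI; first by move: oX; rewrite openE; exact.
apply: (cF _ Xy); exact: open_nbhs_nbhs.
Qed.

End VectorComposition.

(** * Expectations and conditional expectations *)

Section RealExpectation.
Context d (T : measurableType d) {R : realType} (Q : probability T R).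
Implicit Types X Y : T -> R.

Definition rintegrable X : Prop := Q.-integrable setT (EFin \o X).
Definition rexp X : R := \int[Q]_w X w.

Lemma rintegrable_measurable X : rintegrable X -> measurable_fun setT X.
Proof. by case/integrableP => /measurable_EFinP. Qed.

Lemma rintegrable_dom X Y : measurable_fun setT X -> rintegrable Y ->
  {ae Q, forall w, `|X w| <= Y w} -> rintegrable X.
Proof.
move=> mX iY XY; apply/integrableP; split; first exact/measurable_EFinP.
have mY := rintegrable_measurable iY; have [_ Yoo] := integrableP _ _ _ iY.
apply: le_lt_trans Yoo; apply: ae_ge0_le_integral => //.
- by do 2 apply: measurableT_comp => //.
- by do 2 apply: measurableT_comp => //.
- apply: filterS XY => w h _ /=; rewrite lee_fin.
  exact: le_trans h (ler_norm _).
Qed.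

Lemma rintegrable_bounded X (M : R) : measurable_fun setT X ->
  {ae Q, forall w, `|X w| <= M} -> rintegrable X.
Proof.
move=> mX XM; apply: rintegrable_dom XM => //.
exact: finite_measure_integrable_cst.
Qed.

Lemma rintegrableD X Y : rintegrable X -> rintegrable Y ->
  rintegrable (fun w => X w + Y w).
Proof.
move=> iX iY; have := integrableD measurableT iX iY.
by apply: eq_integrable.
Qed.

Lemma rintegrableZ (a : R) X : rintegrable X -> rintegrable (fun w => a * X w).
Proof.
move=> iX; have := integrableZl measurableT a iX.
by apply: eq_integrable.
Qed.

Lemma rintegrableB X Y : rintegrable X -> rintegrable Y ->
  rintegrable (fun w => X w - Y w).
Proof.
move=> iX iY; have := integrableB measurableT iX iY.
by apply: eq_integrable.
Qed.

Lemma rintegrable_cst (a : R) : rintegrable (fun=> a).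
Proof. exact: finite_measure_integrable_cst. Qed.

Lemma rintegrable_sum (I : Type) (s : seq I) (X : I -> T -> R) :
  (forall i, rintegrable (X i)) -> rintegrable (fun w => \sum_(i <- s) X i w).
Proof.
move=> iX; elim: s => [|i s IH].
  by under eq_fun do rewrite big_nil; exact: rintegrable_cst.
by under eq_fun do rewrite big_cons; exact: rintegrableD.
Qed.

Lemma rexpD X Y : rintegrable X -> rintegrable Y ->
  rexp (fun w => X w + Y w) = rexp X + rexp Y.
Proof. exact: RintegralD. Qed.

Lemma rexpB X Y : rintegrable X -> rintegrable Y ->
  rexp (fun w => X w - Y w) = rexp X - rexp Y.
Proof. exact: RintegralB. Qed.

Lemma rexpZ (a : R) X : rintegrable X -> rexp (fun w => a * X w) = a * rexp X.
Proof. exact: RintegralZl. Qed.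

Lemma rexp_cst (a : R) : rexp (fun=> a) = a.
Proof.
rewrite /rexp Rintegral_cst//; have -> : fine (Q setT) = 1 by rewrite probability_setT.
exact: mulr1.
Qed.

Lemma rexp_sum (I : Type) (s : seq I) (X : I -> T -> R) :
  (forall i, rintegrable (X i)) ->
  rexp (fun w => \sum_(i <- s) X i w) = \sum_(i <- s) rexp (X i).
Proof.
move=> iX; elim: s => [|i s IH].
  by under eq_fun do rewrite big_nil; rewrite big_nil rexp_cst.
under eq_fun do rewrite big_cons.
by rewrite big_cons rexpD ?IH//; exact: rintegrable_sum.
Qed.

Lemma rexp_ge0_ae X : rintegrable X -> {ae Q, forall w, 0 <= X w} -> 0 <= rexp X.
Proof.
move=> iX X0; rewrite /rexp /Rintegral.
rewrite (@ae_eq_integral _ _ _ Q setT (fun w => `|X w|%:E)) //.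
- by apply: fine_ge0; apply: integral_ge0.
- exact/measurable_EFinP/rintegrable_measurable.
- by apply/measurable_EFinP; apply: measurableT_comp => //; exact: rintegrable_measurable.
- by apply: filterS X0 => w h _; rewrite ger0_norm.
Qed.

Lemma le_rexp_ae X Y : rintegrable X -> rintegrable Y ->
  {ae Q, forall w, X w <= Y w} -> rexp X <= rexp Y.
Proof.
move=> iX iY XY; rewrite -subr_ge0 -rexpB//; apply: rexp_ge0_ae.
  exact: rintegrableB.
by apply: filterS XY => w; rewrite subr_ge0.
Qed.

Lemma eq_rexp_ae X Y : rintegrable X -> rintegrable Y ->
  {ae Q, forall w, X w = Y w} -> rexp X = rexp Y.
Proof.
move=> iX iY XY; apply/eqP; rewrite eq_le; apply/andP; split.
  by apply: le_rexp_ae => //; apply: filterS XY => w ->.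
by apply: le_rexp_ae => //; apply: filterS XY => w ->.
Qed.

Lemma rintegrableM_bounded X Y (M : R) : measurable_fun setT X -> rintegrable Y ->
  {ae Q, forall w, `|X w| <= M} -> rintegrable (fun w => X w * Y w).
Proof.
move=> mX iY XM; apply: (@rintegrable_dom _ (fun w => M * `|Y w|)).
- apply: measurable_funM => //; exact: rintegrable_measurable.
- by apply: rintegrableZ; exact: (integrable_norm iY).
- by apply: filterS XM => w h; rewrite normrM ler_wpM2r.
Qed.

Lemma rexp_indic_Rintegral X (A : set T) :
  rexp (fun w => \1_A w * X w) = \int[Q]_(w in A) X w.
Proof.
rewrite Rintegral_mkcond; apply: eq_Rintegral => w _.
by rewrite patchE indicE; case: (w \in A); rewrite ?mul1r ?mul0r.
Qed.

End RealExpectation.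

(** * Approximation of a number in [0, 1] by counting levels *)

Section LayerCount.
Context {R : realType}.

(** The sum counts the integers from 1 to [k] that do not exceed [x]: it is the integer part of [x],
    capped at [k]. *)
Lemma layer_count (x : R) (k : nat) : 0 <= x ->
  if k%:R <= x then \sum_(j < k) (j.+1%:R <= x)%R%:R = k%:R :> R
  else \sum_(j < k) (j.+1%:R <= x)%R%:R <= x < \sum_(j < k) (j.+1%:R <= x)%R%:R + 1.
Proof.
move=> x0; elim: k => [|k IH]; first by rewrite x0 big_ord0.
rewrite big_ord_recr /=; case: (leP k.+1%:R x) => hk1.
  have hk : k%:R <= x by apply: le_trans hk1; rewrite ler_nat.
  by rewrite hk in IH; rewrite IH natr1.
rewrite addr0; case: ifP IH => [hk ->|//].
by rewrite hk natr1 hk1.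
Qed.

Lemma layer_approx (x : R) (k : nat) : 0 <= x -> x <= 1 ->
  `|x - k.+1%:R^-1 * \sum_(j < k.+1) (j.+1%:R / k.+1%:R <= x)%R%:R| <= k.+1%:R^-1.
Proof.
move=> x0 x1; have k0 : 0 < k.+1%:R :> R by rewrite ltr0n.
have -> : x - k.+1%:R^-1 * \sum_(j < k.+1) (j.+1%:R / k.+1%:R <= x)%R%:R
  = k.+1%:R^-1 * (x * k.+1%:R - \sum_(j < k.+1) (j.+1%:R <= x * k.+1%:R)%R%:R).
  rewrite mulrBr [_^-1 * (x * _)]mulrC mulfK ?gt_eqF//; congr (_ - _ * _).
  by apply: eq_bigr => j _; rewrite ler_pdivrMr.
rewrite normrM ger0_norm ?invr_ge0 ?(ltW k0)// ler_piMr ?invr_ge0 ?(ltW k0)//.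
have := @layer_count (x * k.+1%:R) k.+1 (mulr_ge0 x0 (ltW k0)).
case: ifP => [h ->|_ /andP[h1 h2]].
  have -> : x * k.+1%:R = k.+1%:R by apply/eqP; rewrite eq_le h andbT ler_piMl// ltW.
  by rewrite subrr normr0.
by rewrite ler_norml; apply/andP; split; lra.
Qed.

End LayerCount.

(** * Pulling a measurable factor out of a conditional expectation *)

Section PullOut.
Context d (T : measurableType d) {R : realType} (Q : probability T R).
Variables (C : set (set T)).
Hypothesis C_meas : <<s C >> `<=` measurable.
Let TC := g_sigma_algebraType C.

Lemma coarse_measurable (h : T -> R) :
  @measurable_fun _ _ TC _ setT h -> measurable_fun setT h.
Proof. by move=> mh _ B mB; apply: C_meas; exact: mh. Qed.

Variables X Z : T -> R.
Hypothesis XZ : is_cond_exp Q <<s C >> X Z.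

Let iX : rintegrable Q X. Proof. exact: ce_integrable XZ. Qed.
Let iZ : rintegrable Q Z. Proof. exact: ce_integrable_version XZ. Qed.

Lemma cond_exp_total : rexp Q X = rexp Q Z.
Proof.
congr fine; apply: (ce_integral XZ).
exact: (@measurableT _ TC).
Qed.

(* A multiplier with values in [0, 1] is a uniform limit of averages of
   indicators of its superlevel sets. *)
Let pullout01 (h : T -> R) : @measurable_fun _ _ TC _ setT h ->
  (forall w, 0 <= h w <= 1) -> rexp Q (fun w => h w * (X w - Z w)) = 0.
Proof.
move=> mh h01; have mh' := coarse_measurable mh.
pose Y w := X w - Z w.
have iY : rintegrable Q Y by exact: rintegrableB.
have inY : rintegrable Q (fun w => `|Y w|) by exact: (integrable_norm iY).
pose A k j := [set w : T | j.+1%:R / k.+1%:R <= h w].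
have GA k j : <<s C >> (A k j).
  have := mh measurableT _ (measurable_itv `[j.+1%:R / k.+1%:R, +oo[).
  rewrite setTI; congr (<<s C >> _); apply/seteqP.
  by split => w /=; rewrite in_itv /= andbT.
have mA k j : measurable (A k j) := C_meas (GA k j).
(* The superlevel set belongs to the sigma-algebra, on whose members [X] and [Z] have equal
   integrals. *)
have A0 k j : rexp Q (fun w => \1_(A k j) w * Y w) = 0.
  rewrite rexp_indic_Rintegral RintegralB //; last 2 first.
  - by apply: integrableS iX.
  - by apply: integrableS iZ.
  by rewrite /Rintegral (ce_integral XZ (GA k j)) subrr.
have iA k j : rintegrable Q (fun w => \1_(A k j) w * Y w).
  apply: (@rintegrableM_bounded _ _ _ _ _ _ 1) => //.
  by apply/aeW => w; rewrite indicE; case: (w \in _); rewrite ?normr1 ?normr0.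
pose hk k w := k.+1%:R^-1 * \sum_(j < k.+1) (\1_(A k j) w * Y w).
have ihk k : rintegrable Q (hk k).
  by apply: rintegrableZ; apply: rintegrable_sum => j; exact: iA.
have Ehk k : rexp Q (hk k) = 0.
  rewrite rexpZ; last by apply: rintegrable_sum => j; exact: iA.
  rewrite rexp_sum; last by move=> j; exact: iA.
  by rewrite big1 ?mulr0.
have ihY : rintegrable Q (fun w => h w * Y w).
  apply: (@rintegrableM_bounded _ _ _ _ _ _ 1) => //.
  by apply/aeW => w; have /andP[h0 h1] := h01 w; rewrite ger0_norm.
apply/eqP; rewrite -normr_le0; apply/ler_addgt0Pr => e e0; rewrite add0r.
(* The approximation error is at most the mean of [|Y|] over [k + 1]; this [k] brings it under
   [e]. *)
have [k ke] : exists k : nat, rexp Q (fun w => `|Y w|) / e <= k.+1%:R.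
  exists (Num.truncn (rexp Q (fun w => `|Y w|) / e)).
  by rewrite ltW// truncnS_gt.
rewrite -[rexp _ _]subr0 -[X in _ - X](Ehk k) -rexpB//.
have iD : rintegrable Q (fun w => h w * Y w - hk k w) by exact: rintegrableB.
apply: le_trans (le_normr_Rintegral measurableT iD) _.
apply: (@le_trans _ _ (rexp Q (fun w => k.+1%:R^-1 * `|Y w|))).
  apply: le_rexp_ae; [exact: (integrable_norm iD)|exact: rintegrableZ|].
  apply/aeW => w; rewrite /hk.
  have -> : h w * Y w - k.+1%:R^-1 * (\sum_(j < k.+1) \1_(A k j) w * Y w)
    = (h w - k.+1%:R^-1 * \sum_(j < k.+1) (j.+1%:R / k.+1%:R <= h w)%R%:R) * Y w.
    rewrite mulrBl -mulrA mulr_suml; congr (_ - _ * _).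
    apply: eq_bigr => j _; rewrite indicE; congr ((nat_of_bool _)%:R * _).
    by apply/idP/idP; rewrite inE.
  rewrite normrM ler_wpM2r//; have /andP[h0 h1] := h01 w; exact: layer_approx.
by rewrite rexpZ// mulrC ler_pdivrMr// mulrC -ler_pdivrMr.
Qed.

(** An affine map sends the multiplier into [0, 1]; the constant part contributes nothing, since [X]
    and [Z] have the same mean. *)
Lemma cond_exp_pullout (h : T -> R) (M : R) : @measurable_fun _ _ TC _ setT h ->
  (forall w, `|h w| <= M) -> rexp Q (fun w => h w * (X w - Z w)) = 0.
Proof.
move=> mh hM; pose D := `|M| + 1.
have D0 : 0 < D by rewrite ltr_wpDl.
pose h' w := (h w / D + 1) / 2.
have mh'' : @measurable_fun _ _ TC _ setT h'.
  apply: (@measurable_funM _ TC) => //; apply: (@measurable_funD _ TC) => //.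
  exact: (@measurable_funM _ TC).
have iY : rintegrable Q (fun w => X w - Z w) by exact: rintegrableB.
have := pullout01 mh'' _.
have hD w : `|h w / D| <= 1.
  rewrite normrM [`|D^-1|]ger0_norm ?invr_ge0 ?(ltW D0)// ler_pdivrMr// mul1r.
  by rewrite (le_trans (hM w))// /D (le_trans (ler_norm _))// lerDl.
have h'01 w : 0 <= h' w <= 1.
  have := hD w; rewrite ler_norml /h' => /andP[h1 h2].
  by apply/andP; split; lra.
move=> /(_ h'01).
have -> : (fun w => h' w * (X w - Z w)) =
   fun w => (2 * D)^-1 * (h w * (X w - Z w)) + 2^-1 * (X w - Z w).
  by apply/funext => w; rewrite /h'; field; rewrite gt_eqF.
have ih : rintegrable Q (fun w => h w * (X w - Z w)).
  apply: (rintegrableM_bounded (M := M)) => //; first exact: coarse_measurable.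
  exact/aeW.
rewrite rexpD; [|exact: rintegrableZ|exact: rintegrableZ].
rewrite !rexpZ// [X in _ + 2^-1 * X]rexpB// cond_exp_total subrr mulr0 addr0.
by move=> /eqP; rewrite mulf_eq0 invr_eq0 gt_eqF ?mulr_gt0//= => /eqP.
Qed.

End PullOut.

Section TotalExpectation.
Context d (T : measurableType d) {R : realType} (Q : probability T R).

Lemma expectation_rexp (Y : T -> R) : rintegrable Q Y -> ('E_Q[Y] = (rexp Q Y)%:E)%E.
Proof. by move=> iY; rewrite unlock /rexp /Rintegral fineK// integrable_fin_num. Qed.

End TotalExpectation.

(** * One inner iteration of a run *)

Section TrajectoryStep.
Context {R : realType} {n m N : nat}.
Variables (X : set 'cV[R]_n) (f : 'I_N -> 'cV[R]_n -> R) (c : 'cV[R]_n -> 'cV[R]_m).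
Variables (L : R) (gam : 'I_m -> R).
Hypothesis prob : smooth_problem X f c L gam.
Let Gam := \sum_(i < m) gam i.
Variables (zeta kH kl tau au beta sigma epstau tauinit : R) (xinit : 'cV[R]_n).
Variables (b S : nat).
Hypothesis (N_gt0 : (0 < N)%N) (tau_gt0 : 0 < tau) (L_gt0 : 0 < L).
Hypothesis (Gam_ge0 : 0 <= Gam) (beta_gt0 : 0 < beta) (kl_gt0 : 0 < kl).
Hypothesis (zeta_gt0 : 0 < zeta) (kH_gt0 : 0 < kH) (au_gt0 : 0 < au).
Let A := tau * L + Gam.
Let al := kl * tau / A.
Hypothesis (al_au : al < au) (alb_le1 : al * beta <= 1).

Variable t : trajectory R n m N.
Hypothesis run : vr_sqp_run f c L Gam sigma epstau au beta b S xinit tauinit t.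
Hypothesis hess : hessian_ok c zeta kH S t.
Hypothesis X_t : forall k s, (s <= S)%N -> X (tr_x t k s).

Definition tangent_step (k s : nat) : 'cV[R]_n :=
  kkt_step (tr_H t k s) (tr_J c t k s) (tr_g f t k s) 0.

Definition grad_error (k s : nat) : 'cV[R]_n := tr_gbar f b t k s - tr_g f t k s.

(** An upper bound for the stochastic model reduction of which, in mean, only the true reduction and
    the gradient variance remain: the middle term is linear in an error of zero conditional mean. *)
Definition dlbar_bound (k s : nat) : R :=
  tr_dl f c t tau k s
  - tau * dot (tr_d t k s + tangent_step k s) (grad_error k s)
  + tau * (norm2 (grad_error k s) ^+ 2 / zeta).

Lemma jac_full k s : (s <= S)%N ->
  forall y : 'cV[R]_m, (tr_J c t k s)^T *m y = 0 -> y = 0.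
Proof.
move=> sS; have [smin smin0 hs] := sp_jac_sv prob.
by apply: (singular_full smin0) => e; apply: hs; exact: X_t.
Qed.

Variables k s : nat.
Hypothesis sS : (s < S)%N.

(** Uniqueness identifies the given step with the explicit formula, from which its measurability is
    derived later. *)
Lemma tr_d_kkt :
  tr_d t k s = kkt_step (tr_H t k s) (tr_J c t k s) (tr_g f t k s) (tr_c c t k s).
Proof.
have [y hy] := kkt_stepP zeta_gt0 (hess_sym hess k sS) (fun u => hess_curv hess (u := u) sS)
  (jac_full (ltnW sS)) (tr_g f t k s) (tr_c c t k s).
exact: (kkt_uniq zeta_gt0 (fun u => hess_curv hess (u := u) sS) (run_det_system run k sS) hy).
Qed.

Lemma tangent_sys : exists y, sqp_system (tr_H t k s) (tr_J c t k s) (tr_g f t k s) 0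
  (tangent_step k s) y.
Proof.
exact: (kkt_stepP zeta_gt0 (hess_sym hess k sS) (fun u => hess_curv hess (u := u) sS)
  (jac_full (ltnW sS))).
Qed.

Lemma tangent_step_le : zeta * norm2 (tangent_step k s) <= norm2 (tr_g f t k s).
Proof.
have [y [h1 h2]] := tangent_sys; rewrite oppr0 in h2.
by have [] := kkt_norm2_le zeta_gt0 (fun u => hess_curv hess (u := u) sS) h1 h2.
Qed.

Lemma tr_dlbar_le : tr_dlbar f c b t tau k s <= dlbar_bound k s.
Proof.
have [y hy] := tangent_sys.
have := kkt_dot_lower zeta_gt0 (hess_sym hess k sS) (fun u => hess_curv hess (u := u) sS)
  (run_det_system run k sS) (run_system run k sS) hy.
rewrite /dlbar_bound /tr_dlbar /tr_dl /dl -/(grad_error k s).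
move=> /(ler_wpM2l (ltW tau_gt0)); lra.
Qed.

Hypothesis tau_eq : tr_taubar t k s = tau.
Hypothesis Dl_ge : kl * tau * norm2 (tr_d t k s) ^+ 2 <= tr_dl f c t tau k s.
Hypothesis Dlbar_ge : kl * tau * norm2 (tr_dbar t k s) ^+ 2 <= tr_dlbar f c b t tau k s.

Let A_gt0 : 0 < A. Proof. by rewrite /A ltr_wpDr// mulr_gt0. Qed.
Let al_gt0 : 0 < al. Proof. by rewrite /al !mulr_gt0 ?invr_gt0. Qed.

(** Treats a zero and a nonzero [tr_dbar] alike, so that later estimates need only the range of
    [a]. *)
Lemma step_exists : exists a, [/\ al * beta <= a, a <= au * beta,
  tr_x t k s.+1 = tr_x t k s + a *: tr_dbar t k s &
  phi f c (tr_x t k s.+1) tau <= phi f c (tr_x t k s) tau - a * tr_dl f c t tau k s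
    + 2^-1 * a * beta * tr_dlbar f c b t tau k s
    + a * tau * dot (tr_g f t k s) (tr_dbar t k s - tr_d t k s)].
Proof.
have sys := run_system run k sS; have xE := run_x run k sS.
have Xs := X_t k (ltnW sS); have Xs1 := X_t k sS.
case: eqP xE => [db0 xE|/eqP db0 xE]; last first.
  rewrite tau_eq in xE; rewrite {}xE in Xs1 *.
  have [h1 h2 _] := adaptive_step_spec tau_gt0 L_gt0 Gam_ge0 beta_gt0 kl_gt0 al_au alb_le1 db0 Dlbar_ge.
  exists (adaptive_step L Gam au beta (tr_c c t k s) tau (tr_gbar f b t k s) (tr_dbar t k s)).
  split => //.
  exact: (phi_step prob N_gt0 tau_gt0 L_gt0 Gam_ge0 beta_gt0 kl_gt0 al_au alb_le1 db0
     Dlbar_ge _ erefl sys.2 Xs Xs1).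
(* For a zero step any admissible [a] will do: [c] vanishes by the linearized constraint, and the
   terms added to the merit value on the right cancel. *)
exists (al * beta); split => //.
- by rewrite ler_wpM2r// ltW.
- by rewrite db0 scaler0 addr0.
have c0 : norm1 (tr_c c t k s) = 0.
  have /eqP := sys.2; rewrite db0 mulmx0 eq_sym oppr_eq0 => /eqP ->.
  by rewrite /norm1 big1// => i _; rewrite mxE normr0.
rewrite xE /tr_dl /tr_dlbar /dl c0 db0 !dot0r dotBr dot0r.
lra.
Qed.

Let Dl_ge0 : 0 <= tr_dl f c t tau k s.
Proof.
by apply: le_trans Dl_ge; rewrite mulr_ge0 ?sqr_ge0// ltW// mulr_gt0.
Qed.

Let Dlbar_ge0 : 0 <= tr_dlbar f c b t tau k s.
Proof.
by apply: le_trans Dlbar_ge; rewrite mulr_ge0 ?sqr_ge0// ltW// mulr_gt0.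
Qed.

(** Both model reductions are nonnegative, so [a] is replaced by its lower bound in the decrease and
    by its upper bound in the error terms. *)
Lemma phi_next :
  phi f c (tr_x t k s.+1) tau <= phi f c (tr_x t k s) tau
    - al * beta * tr_dl f c t tau k s
    + 2^-1 * au * beta ^+ 2 * dlbar_bound k s
    + au * beta * tau * kH * (norm2 (tr_d t k s) * norm2 (tr_dbar t k s - tr_d t k s)).
Proof.
have [a [a1 a2 _ h]] := step_exists; apply: (le_trans h).
have a0 : 0 <= a by apply: le_trans a1; rewrite mulr_ge0 ?ltW.
have e1 : al * beta * tr_dl f c t tau k s <= a * tr_dl f c t tau k s by rewrite ler_wpM2r.
have e2 : 2^-1 * a * beta * tr_dlbar f c b t tau k s
   <= 2^-1 * au * beta ^+ 2 * dlbar_bound k s.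
  have -> : 2^-1 * au * beta ^+ 2 * dlbar_bound k s
     = 2^-1 * (au * beta) * beta * dlbar_bound k s by ring.
  apply: ler_pM => //; last exact: tr_dlbar_le.
    by rewrite !mulr_ge0 ?(ltW beta_gt0)// invr_ge0.
  by rewrite ler_wpM2r ?(ltW beta_gt0)// ler_wpM2l// invr_ge0.
have e3 : a * tau * dot (tr_g f t k s) (tr_dbar t k s - tr_d t k s)
   <= au * beta * tau * kH * (norm2 (tr_d t k s) * norm2 (tr_dbar t k s - tr_d t k s)).
  have := kkt_dot_diff_le (hess_sym hess k sS)
    (run_det_system run k sS) (run_system run k sS)
    (fun u => hess_bounded hess k u sS).
  move=> /(ler_wpM2l (mulr_ge0 a0 (ltW tau_gt0))) /le_trans; apply.
  move: (norm2 (tr_d t k s)) (norm2_ge0 (tr_d t k s)) => q q0.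
  move: (norm2 _) (norm2_ge0 (tr_dbar t k s - tr_d t k s)) => u u0.
  have -> : a * tau * (kH * q * u) = a * (tau * kH * q * u) by ring.
  have -> : au * beta * tau * kH * (q * u) = au * beta * (tau * kH * q * u) by ring.
  by rewrite ler_wpM2r// !mulr_ge0// ltW.
lra.
Qed.

(** Young's inequality, with the squared step length bounded by the stochastic model reduction and
    hence by [dlbar_bound]. *)
Lemma dist_next (z : R) : 0 < z ->
  norm2 (tr_x t k s.+1 - tr_x t k 0) ^+ 2 <=
    (1 + z) * norm2 (tr_x t k s - tr_x t k 0) ^+ 2
    + (1 + z) / z * ((au * beta) ^+ 2 / (kl * tau)) * dlbar_bound k s.
Proof.
move=> z0; have [a [a1 a2 -> _]] := step_exists.
have a0 : 0 <= a by apply: le_trans a1; rewrite mulr_ge0 ?ltW.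
have key : norm2 (a *: tr_dbar t k s) ^+ 2
    <= (au * beta) ^+ 2 / (kl * tau) * dlbar_bound k s.
  rewrite norm2Z// exprMn -[leRHS]mulrA; apply: ler_pM => //; rewrite ?sqr_ge0//.
    by rewrite ler_sqr ?nnegrE// (le_trans a0).
  by rewrite ler_pdivlMl ?mulr_gt0//; exact: le_trans Dlbar_ge tr_dlbar_le.
have z1 : 0 <= (1 + z) / z by rewrite ltW// divr_gt0// addr_gt0.
have := ler_wpM2l z1 key; rewrite [leRHS]mulrA => h.
by rewrite addrAC; apply: le_trans (sqr_norm2D_le _ _ z0) _; rewrite lerD2l.
Qed.

End TrajectoryStep.

Section MoreMeasurability.
Context d (T : measurableType d) {R : realType}.

Lemma measurable_dot n (u v : T -> 'cV[R]_n) : measurable_mx u -> measurable_mx v ->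
  measurable_fun setT (fun w => dot (u w) (v w)).
Proof. by move=> mu mv; apply: measurable_sum => i; exact: measurable_funM. Qed.

Lemma measurable_norm1 n (u : T -> 'cV[R]_n) : measurable_mx u ->
  measurable_fun setT (fun w => norm1 (u w)).
Proof. by move=> mu; apply: measurable_sum => i; exact: measurableT_comp. Qed.

Lemma measurable_norm2 n (u : T -> 'cV[R]_n) : measurable_mx u ->
  measurable_fun setT (fun w => norm2 (u w)).
Proof.
move=> mu; apply: (measurableT_comp (f := @Num.sqrt R)); last exact: measurable_dot.
by apply: continuous_measurable_fun; exact: sqrt_continuous.
Qed.

Lemma measurable_kkt_step n m (H : T -> 'M[R]_n) (J : T -> 'M[R]_(m, n))
    (g : T -> 'cV[R]_n) (c : T -> 'cV[R]_m) :
  measurable_mx H -> measurable_mx J -> measurable_mx g -> measurable_mx c ->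
  (forall w, kkt_matrix (H w) (J w) \in unitmx) ->
  measurable_mx (fun w => kkt_step (H w) (J w) (g w) (c w)).
Proof.
move=> mH mJ mg mc uK; apply: measurable_oppmx => i j.
under eq_fun do rewrite mxE.
move: (lshift m i) j; apply: measurable_mulmx.
  apply: measurable_invmx => //; apply: measurable_block => //.
    exact: measurable_trmx.
move=> k j; case: (split_ordP k) => k' ->.
  by under eq_fun do rewrite col_mxEu; exact: mg.
by under eq_fun do rewrite col_mxEd; exact: mc.
Qed.

End MoreMeasurability.

(** * Boundedness and measurability of the problem functions *)

Section Bounds.
Context {R : realType} {n m N : nat}.
Variables (X : set 'cV[R]_n) (f : 'I_N -> 'cV[R]_n -> R) (c : 'cV[R]_n -> 'cV[R]_m).
Variables (L : R) (gam : 'I_m -> R).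
Hypothesis prob : smooth_problem X f c L gam.

(** Boundedness is given in the max norm; passing to the Euclidean norm costs a factor of the square
    root of [n]. *)
Lemma grad_bound : exists2 B, 0 <= B & forall x, X x -> norm2 (grad (favg f) x) <= B.
Proof.
have [M [_ /(_ (`|M| + 1))]] := sp_gradf_bounded prob.
have M1 : M < `|M| + 1 by rewrite (le_lt_trans (ler_norm _))// ltrDl.
move=> /(_ M1) hM; exists (Num.sqrt (n%:R * (`|M| + 1) ^+ 2)); first exact: sqrtr_ge0.
move=> x Xx; apply: ler_wsqrtr; rewrite /dot mulr_natl -[n in _ *+ n]card_ord -sumr_const.
apply: ler_sum => i _; rewrite -expr2 -real_normK ?num_real// ler_sqr ?nnegrE ?addr_ge0//.
apply: le_trans (hM x Xx); rewrite [leRHS]/Num.Def.normr/= mx_normrE.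
by rewrite (le_trans _ (le_bigmax _ _ (i, ord0))).
Qed.

Lemma norm1_c_bound : exists2 B, 0 <= B & forall x, X x -> norm1 (c x) <= B.
Proof.
have /choice[M hM] : forall i, exists M, forall x, X x -> `|c x i 0| <= M.
  move=> i; have [M [_ /(_ (`|M| + 1))]] := sp_ci_bounded prob i.
  have M1 : M < `|M| + 1 by rewrite (le_lt_trans (ler_norm _))// ltrDl.
  by move=> /(_ M1) h; exists (`|M| + 1) => x /h.
exists (\sum_i `|M i|); first by rewrite sumr_ge0.
move=> x Xx; apply: ler_sum => i _.
exact: le_trans (hM i x Xx) (ler_norm _).
Qed.

Lemma phi_bound (tau : R) : exists B, forall x, X x -> `|phi f c x tau| <= B.
Proof.
have [M [_ /(_ (`|M| + 1))]] := sp_f_bounded prob.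
have M1 : M < `|M| + 1 by rewrite (le_lt_trans (ler_norm _))// ltrDl.
move=> /(_ M1) hM; have [B B0 hB] := norm1_c_bound.
exists (`|tau| * (`|M| + 1) + B) => x Xx; rewrite /phi.
apply: le_trans (ler_normD _ _) _; apply: lerD.
  by rewrite normrM ler_wpM2l//; exact: hM.
by rewrite ger0_norm ?norm1_ge0// hB.
Qed.

Section Composed.
Context d (T : measurableType d) (x : T -> 'cV[R]_n).
Hypothesis (mx : measurable_mx x) (Xx : forall w, X (x w)).

Lemma measurable_c : measurable_mx (fun w => c (x w)).
Proof.
move=> i j; rewrite (ord1 j).
apply: (measurable_continuous_comp mx (F := coordf c i) (sp_open prob)) => //.
by move=> y Xy; apply: differentiable_continuous; exact: sp_ci_diff prob i y Xy.
Qed.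

Lemma measurable_jac : measurable_mx (fun w => jac c (x w)).
Proof.
move=> i j; under eq_fun do rewrite mxE.
apply: (measurable_continuous_comp mx (F := fun y => grad (coordf c i) y j 0) (sp_open prob)) => //.
move=> y Xy; apply: (@continuous_comp _ _ _ (grad (coordf c i))
  (fun M : 'cV[R]_n => M j 0)); first exact: sp_ci_C1 prob i y Xy.
exact: coord_continuous.
Qed.

Lemma measurable_phi (tau : R) : measurable_fun setT (fun w => phi f c (x w) tau).
Proof.
apply: measurable_funD; last by apply: measurable_norm1; exact: measurable_c.
apply: measurable_funM => //.
apply: (measurable_continuous_comp mx (F := favg f) (sp_open prob)) => //.
by move=> y Xy; exact: differentiable_continuous (differentiable_favg prob Xy).
Qed.

End Composed.

End Bounds.

(** * Expected decrease over an outer iteration *)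

(** Arithmetic core of [expected_step] on abstract reals: [v] is the mean of [dlbar_bound], [u] the
    mean bias term, and [r], [r1] are weighted mean distances. *)
Lemma merit_combine (R : realFieldType) (p1 p a k1 k2 l3 v u vb ub r1 r : R) :
  p1 <= p - a + k1 * v + k2 * u -> r1 <= r + l3 * v ->
  (k1 + l3) * v <= vb -> k2 * u <= ub -> p1 + r1 <= p - a + r + vb + ub.
Proof. by rewrite mulrDl; lra. Qed.

Lemma telescope_step (R : realFieldType) (nu D Lam sD v0 v v1 : R) :
  nu * sD <= v0 - v -> v1 <= v - Lam * D -> nu * D <= Lam * D ->
  nu * sD + nu * D <= v0 - v1.
Proof. by lra. Qed.

(** Truncation to [-M, M]. The step is bounded only on the merit event, while a factor to be pulled
    out must be bounded everywhere; truncation achieves this, keeps measurability and changes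
    nothing on the event. *)
Definition clip (R : realType) (M x : R) : R := Num.max (- M) (Num.min M x).

Lemma clip_le (R : realType) (M x : R) : 0 <= M -> `|clip M x| <= M.
Proof.
move=> M0; rewrite ler_norml /clip le_max lexx /= ge_max ge_min lexx orTb andbT.
by rewrite lerNl (le_trans _ M0)// oppr_le0.
Qed.

Lemma clip_id (R : realType) (M x : R) : `|x| <= M -> clip M x = x.
Proof. by rewrite ler_norml /clip => /andP[h1 h2]; rewrite min_r// max_r. Qed.

Lemma measurable_clip d (T : measurableType d) (R : realType) (M : R) (h : T -> R) :
  measurable_fun setT h -> measurable_fun setT (fun w => clip M (h w)).
Proof. by move=> mh; apply: measurable_maxr => //; exact: measurable_minr. Qed.

Section RandomStep.
Context {R : realType} {n m N : nat}.
Variables (X : set 'cV[R]_n) (f : 'I_N -> 'cV[R]_n -> R) (c : 'cV[R]_n -> 'cV[R]_m).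
Variables (L : R) (gam : 'I_m -> R).
Hypothesis prob : smooth_problem X f c L gam.
Let Gam := \sum_(i < m) gam i.
Variables (zeta kH kl kd tau au beta sigma epstau tauinit : R) (xinit : 'cV[R]_n).
Variables (b S : nat).
Hypothesis (N_gt0 : (0 < N)%N) (tau_gt0 : 0 < tau) (L_gt0 : 0 < L).
Hypothesis (Gam_ge0 : 0 <= Gam) (beta_gt0 : 0 < beta) (kl_gt0 : 0 < kl) (kd_gt0 : 0 < kd).
Hypothesis (zeta_gt0 : 0 < zeta) (kH_gt0 : 0 < kH) (au_gt0 : 0 < au) (b_gt0 : (0 < b)%N).
Let A := tau * L + Gam.
Let al := kl * tau / A.
Hypothesis (al_au : al < au) (alb_le1 : al * beta <= 1).
Hypothesis S_gt0 : (0 < S)%N.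

Context (disp : measure_display) (T : measurableType disp) (P Q : probability T R).
Variable W : T -> trajectory R n m N.
Hypothesis rr : random_run W S.
Hypothesis run : forall w, vr_sqp_run f c L Gam sigma epstau au beta b S xinit tauinit (W w).
Hypothesis X_W : forall w k s, (s <= S)%N -> X (tr_x (W w) k s).
Hypothesis hess : forall w, hessian_ok c zeta kH S (W w).
Variable kt : nat.
Let E := merit_event f c sigma tau S kt W.
Hypothesis mE : measurable E.
Hypothesis condQ : conditioned_on P Q E.
Hypothesis ge : gradient_estimates W Q f L b S.
Hypothesis kl_ok : forall w k s, E w -> (s < S)%N ->
  kl * tr_taubar (W w) k s * norm2 (tr_d (W w) k s) ^+ 2
    <= tr_dl f c (W w) (tr_taubar (W w) k s) k s /\
  kl * tr_taubar (W w) k s * norm2 (tr_dbar (W w) k s) ^+ 2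
    <= tr_dlbar f c b (W w) (tr_taubar (W w) k s) k s.
Hypothesis kd_ok : forall k s, (s < S)%N ->
  cond_exp_le Q (reached W k s)
    (fun w => norm2 (tr_dbar (W w) k s - tr_d (W w) k s))
    (fun w => kd * Num.sqrt (tr_M L b (W w) k s)).

(** The [Q]-mass of the complement of [E] is a multiple of the [P]-mass of the empty set. *)
Lemma ae_merit_event : {ae Q, forall w, E w}.
Proof.
exists (~` E); split; [exact: measurableC| |by []].
by rewrite condQ; [rewrite setICl measure0 mul0e|exact: measurableC].
Qed.

(* Generators of [reached W k s]: on [g_sigma_algebraType (reached_gen k s)],
   measurability is measurability with respect to [reached W k s]. *)
Definition reached_gen (k s : nat) : set (set T) :=
  [set A | exists2 Y, [set Y : T -> R | [\/ exists i, Y = (fun w => tr_x (W w) k 0 i 0),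
                        exists i, Y = (fun w => tr_x (W w) k s i 0) |
                        exists i j, Y = (fun w => tr_H (W w) k s i j)]] Y &
           exists2 B, measurable B & Y @^-1` B = A].

Lemma reached_measurable k s : (s < S)%N -> <<s reached_gen k s>> `<=` measurable.
Proof.
move=> sS; apply: smallest_sub; first exact: sigma_algebra_measurable.
move=> _ [Y hY [B mB <-]]; suff mY : measurable_fun setT Y.
  by rewrite -[_ @^-1` _]setTI; exact: mY.
case: hY => [[i ->]|[i ->]|[i [j ->]]].
- exact: (rr_x rr k i S_gt0).
- exact: (rr_x rr k i sS).
- exact: (rr_H rr k i j sS).
Qed.

Let TC k s := g_sigma_algebraType (reached_gen k s).

Lemma reached_x k s : @measurable_mx _ (TC k s) R _ _ (fun w => tr_x (W w) k s).
Proof.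
move=> i j; rewrite (ord1 j) => _ B mB; rewrite setTI; apply: sub_sigma_algebra.
by exists (fun w => tr_x (W w) k s i 0); [apply: Or32; exists i|exists B].
Qed.

Lemma reached_H k s : @measurable_mx _ (TC k s) R _ _ (fun w => tr_H (W w) k s).
Proof.
move=> i j _ B mB; rewrite setTI; apply: sub_sigma_algebra.
by exists (fun w => tr_H (W w) k s i j); [apply: Or33; exists i, j|exists B].
Qed.

(** By hypothesis [tr_g] is a version of the conditional expectation of [tr_gbar], hence measurable
    for the conditioning sigma-algebra. *)
Lemma reached_g k s : (s < S)%N ->
  @measurable_mx _ (TC k s) R _ _ (fun w => tr_g f (W w) k s).
Proof.
move=> sS i j; rewrite (ord1 j) => _ B mB; rewrite setTI.
exact: (ce_measurable (ge_gbar ge k i sS)).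
Qed.

Lemma kkt_unit_W w k s : (s < S)%N ->
  kkt_matrix (tr_H (W w) k s) (tr_J c (W w) k s) \in unitmx.
Proof.
move=> sS; apply: (kkt_unit zeta_gt0 (hess_sym (hess w) k sS)).
- by move=> u; exact: (hess_curv (hess w) sS).
- exact: (jac_full prob (X_W w) (ltnW sS)).
Qed.

Lemma reached_c k s : (s < S)%N ->
  @measurable_mx _ (TC k s) R _ _ (fun w => tr_c c (W w) k s).
Proof.
move=> sS; apply: (@measurable_c _ _ _ _ _ _ _ _ _ prob _ (TC k s)); first exact: reached_x.
by move=> w; exact: X_W (ltnW sS).
Qed.

Lemma reached_J k s : (s < S)%N ->
  @measurable_mx _ (TC k s) R _ _ (fun w => tr_J c (W w) k s).
Proof.
move=> sS; apply: (@measurable_jac _ _ _ _ _ _ _ _ _ prob _ (TC k s)); first exact: reached_x.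
by move=> w; exact: X_W (ltnW sS).
Qed.

(** By the explicit KKT formula the deterministic step is a function of data fixed when x_{k,s} is
    reached. *)
Lemma reached_d k s : (s < S)%N ->
  @measurable_mx _ (TC k s) R _ _ (fun w => tr_d (W w) k s).
Proof.
move=> sS.
have -> : (fun w => tr_d (W w) k s) = fun w =>
   kkt_step (tr_H (W w) k s) (tr_J c (W w) k s) (tr_g f (W w) k s) (tr_c c (W w) k s).
  by apply/funext => w; rewrite (tr_d_kkt prob zeta_gt0 (run w) (hess w) (X_W w) k sS).
apply: (@measurable_kkt_step _ (TC k s)).
- exact: reached_H.
- exact: reached_J.
- exact: reached_g.
- exact: reached_c.
- by move=> w; exact: kkt_unit_W.
Qed.

Lemma reached_tangent k s : (s < S)%N ->
  @measurable_mx _ (TC k s) R _ _ (fun w => tangent_step f c (W w) k s).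
Proof.
move=> sS; apply: (@measurable_kkt_step _ (TC k s)).
- exact: reached_H.
- exact: reached_J.
- exact: reached_g.
- by move=> i j; exact: (@measurable_cst _ _ (TC k s)).
- by move=> w; exact: kkt_unit_W.
Qed.

Lemma coarse_mx k s p q (M : T -> 'M[R]_(p, q)) : (s < S)%N ->
  @measurable_mx _ (TC k s) R _ _ M -> measurable_mx M.
Proof. by move=> sS mM i j; exact: (coarse_measurable (reached_measurable sS) (mM i j)). Qed.

Lemma measurable_x k s : (s <= S)%N -> measurable_mx (fun w => tr_x (W w) k s).
Proof.
rewrite leq_eqVlt => /predU1P[->|sS] i j; rewrite (ord1 j); last exact: (rr_x rr k i sS).
(* Measurability is assumed for [s < S] only; the last inner iterate is the first one of the next
   outer iteration. *)
under eq_fun do rewrite -(run_x_outer (run _)).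
exact: (rr_x rr _ i S_gt0).
Qed.

(** On [E] the lower bound on the model reduction gives [kl * tau * r ^ 2 <= tau * Gb * r + Cb] for
    the norm [r] of the step, which bounds [r]. *)
Lemma d_bounded k : (kt <= k)%N -> exists2 B, 0 <= B &
  forall w s, E w -> (s < S)%N -> norm2 (tr_d (W w) k s) <= B.
Proof.
move=> ktk; have [Gb G0 hG] := grad_bound prob; have [Cb C0 hC] := norm1_c_bound prob.
have klt : 0 < kl * tau by rewrite mulr_gt0.
have K0 : 0 <= (tau * Gb + Cb) / (kl * tau).
  by rewrite divr_ge0 ?(ltW klt)// addr_ge0// mulr_ge0// ltW.
exists (1 + (tau * Gb + Cb) / (kl * tau)); first by rewrite addr_ge0.
move=> w s Ew sS; have [te _] := Ew _ _ ktk sS.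
have [+ _] := kl_ok k Ew sS; rewrite te /tr_dl /dl => h.
have hg := hG _ (X_W w k (ltnW sS)); have hc := hC _ (X_W w k (ltnW sS)).
have cs : - tau * dot (tr_g f (W w) k s) (tr_d (W w) k s) <= tau * (Gb * norm2 (tr_d (W w) k s)).
  rewrite mulNr -mulrN ler_wpM2l ?(ltW tau_gt0)// -dotNl.
  apply: le_trans (dot_le_norm2 _ _) _; rewrite norm2N.
  by rewrite ler_wpM2r ?norm2_ge0.
move: (norm2 (tr_d _ _ _)) h cs (norm2_ge0 (tr_d (W w) k s)) => r h cs r0.
have [r1|r1] := leP r 1; first by rewrite (le_trans r1)// lerDl.
suff : r <= (tau * Gb + Cb) / (kl * tau) by move=> /le_trans; apply; rewrite lerDr.
rewrite ler_pdivlMr//.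
have r00 : 0 < r by lra.
rewrite -(ler_pM2r r00) mulrAC -expr2 mulrC.
have : norm1 (tr_c c (W w) k s) <= Cb * r.
  by rewrite (le_trans hc)// ler_peMr// ltW.
by move: h cs; lra.
Qed.

Lemma tangent_bounded : exists2 B, 0 <= B &
  forall w k s, (s < S)%N -> norm2 (tangent_step f c (W w) k s) <= B.
Proof.
have [Gb G0 hG] := grad_bound prob; exists (Gb / zeta); first by rewrite divr_ge0// ltW.
move=> w k s sS; rewrite ler_pdivlMr// mulrC.
apply: le_trans (tangent_step_le prob zeta_gt0 (hess w) (X_W w) k sS) _.
exact: hG (X_W w k (ltnW sS)).
Qed.

Lemma rintegrable_ae_eq (Y Z : T -> R) : measurable_fun setT Y -> rintegrable Q Z ->
  {ae Q, forall w, Y w = Z w} -> rintegrable Q Y.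
Proof.
move=> mY iZ YZ; apply: (rintegrable_dom mY (integrable_norm iZ)).
by apply: filterS YZ => w ->.
Qed.

Lemma rintegrable_grad_error k s : (s < S)%N ->
  rintegrable Q (fun w => norm2 (grad_error f b (W w) k s) ^+ 2).
Proof. by move=> sS; have [Z hZ _] := ge_var ge k sS; exact: ce_integrable hZ. Qed.

Lemma rexp_grad_error_le k s : (s < S)%N ->
  rintegrable Q (fun w => norm2 (tr_x (W w) k s - tr_x (W w) k 0) ^+ 2) ->
  rexp Q (fun w => norm2 (grad_error f b (W w) k s) ^+ 2) <=
  L ^+ 2 / b%:R * rexp Q (fun w => norm2 (tr_x (W w) k s - tr_x (W w) k 0) ^+ 2).
Proof.
move=> sS ir; have [Z hZ ZM] := ge_var ge k sS.
rewrite (cond_exp_total (C := reached_gen k s) hZ) -rexpZ//.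
apply: le_rexp_ae ZM; first exact: ce_integrable_version hZ.
exact: rintegrableZ.
Qed.

(** * Mean estimates within an outer iteration once the merit parameter has settled *)

Section AfterKt.
Variable k : nat.
Hypothesis ktk : (kt <= k)%N.

Let Dl s w := tr_dl f c (W w) tau k s.
Let dist s w := norm2 (tr_x (W w) k s - tr_x (W w) k 0) ^+ 2.
Let cross s w := dot (tr_d (W w) k s + tangent_step f c (W w) k s) (grad_error f b (W w) k s).
Let shift_d s w := norm2 (tr_dbar (W w) k s - tr_d (W w) k s).

Lemma measurable_dist s : (s <= S)%N -> measurable_fun setT (dist s).
Proof.
move=> sS; apply: measurable_funX; apply: measurable_norm2.
apply: measurable_addmx; first exact: measurable_x.
by apply: measurable_oppmx; exact: measurable_x.
Qed.

Lemma measurable_gbar s : (s < S)%N -> measurable_mx (fun w => tr_gbar f b (W w) k s).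
Proof.
move=> sS i j; rewrite (ord1 j).
exact: (rintegrable_measurable (ce_integrable (ge_gbar ge k i sS))).
Qed.

Lemma measurable_dl s : (s < S)%N -> measurable_fun setT (Dl s).
Proof.
move=> sS; apply: measurable_funD.
  apply: measurable_funM => //; apply: measurable_dot.
    by apply: (coarse_mx sS); exact: reached_g.
  by apply: (coarse_mx sS); exact: reached_d.
by apply: measurable_norm1; apply: (coarse_mx sS); exact: reached_c.
Qed.

Lemma dl_lower w s : E w -> (s < S)%N -> kl * tau * norm2 (tr_d (W w) k s) ^+ 2 <= Dl s w.
Proof.
by move=> Ew sS; have [te _] := Ew _ _ ktk sS; have [+ _] := kl_ok k Ew sS; rewrite te.
Qed.

Lemma dl_ge0 w s : E w -> (s < S)%N -> 0 <= Dl s w.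
Proof.
move=> Ew sS; apply: le_trans (dl_lower Ew sS).
by rewrite mulr_ge0 ?sqr_ge0// ltW// mulr_gt0.
Qed.

Lemma dlbar_lower w s : E w -> (s < S)%N ->
  kl * tau * norm2 (tr_dbar (W w) k s) ^+ 2 <= tr_dlbar f c b (W w) tau k s.
Proof.
by move=> Ew sS; have [te _] := Ew _ _ ktk sS; have [_ +] := kl_ok k Ew sS; rewrite te.
Qed.

Lemma rintegrable_dl s : (s < S)%N -> rintegrable Q (Dl s).
Proof.
move=> sS; have [Gb G0 hG] := grad_bound prob; have [Cb C0 hC] := norm1_c_bound prob.
have [B B0 hB] := d_bounded ktk.
apply: (rintegrable_bounded (M := tau * (Gb * B) + Cb)); first exact: measurable_dl.
apply: filterS ae_merit_event => w Ew; rewrite ger0_norm ?dl_ge0//.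
apply: lerD; last exact: hC (X_W w k (ltnW sS)).
rewrite mulNr -mulrN ler_wpM2l ?(ltW tau_gt0)// -dotNl.
apply: le_trans (dot_le_norm2 _ _) _; rewrite norm2N.
by rewrite ler_pM ?norm2_ge0// ?hB// hG//; exact: X_W (ltnW sS).
Qed.

(** Componentwise, the coefficient is known when x_{k,s} is reached and the gradient error has zero
    conditional mean, so the coefficient is pulled out, after clipping. *)
Lemma cross_spec s : (s < S)%N -> rintegrable Q (cross s) /\ rexp Q (cross s) = 0.
Proof.
move=> sS; have [B1 B10 hB1] := d_bounded ktk; have [B2 B20 hB2] := tangent_bounded.
pose h i w := clip (B1 + B2) ((tr_d (W w) k s + tangent_step f c (W w) k s) i 0).
have mh i : @measurable_fun _ _ (TC k s) _ setT (h i).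
  apply: (@measurable_clip _ (TC k s)); apply: (@measurable_addmx _ (TC k s)).
    exact: reached_d.
  exact: reached_tangent.
have hle i w : `|h i w| <= B1 + B2 by apply: clip_le; exact: addr_ge0.
pose Y i w := h i w * (tr_gbar f b (W w) k s i 0 - tr_g f (W w) k s i 0).
have ge_i i := ge_gbar ge k i sS.
have iY i : rintegrable Q (Y i).
  apply: (rintegrableM_bounded (M := B1 + B2)).
  - exact: (coarse_measurable (reached_measurable sS)).
  - by apply: rintegrableB; [exact: ce_integrable (ge_i i)|exact: ce_integrable_version (ge_i i)].
  - exact/aeW.
have EY i : rexp Q (Y i) = 0.
  exact: (cond_exp_pullout (reached_measurable sS) (ge_i i) (mh i) (hle i)).
have crossE : {ae Q, forall w, cross s w = \sum_i Y i w}.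
  apply: filterS ae_merit_event => w Ew; rewrite /cross /dot; apply: eq_bigr => i _.
  rewrite /Y /h clip_id; first by rewrite /grad_error !mxE.
  rewrite mxE (le_trans (ler_normD _ _))// lerD//.
    by rewrite (le_trans (normr_le_norm2 _ _))// hB1.
  by rewrite (le_trans (normr_le_norm2 _ _))// hB2.
have iS : rintegrable Q (fun w => \sum_i Y i w) by exact: rintegrable_sum.
have iC : rintegrable Q (cross s).
  apply: rintegrable_ae_eq crossE => //; apply: measurable_dot.
    by apply: measurable_addmx; apply: (coarse_mx sS); [exact: reached_d|exact: reached_tangent].
  apply: measurable_addmx; first exact: measurable_gbar.
  by apply: measurable_oppmx; apply: (coarse_mx sS); exact: reached_g.
split => //; rewrite (eq_rexp_ae iC iS crossE) rexp_sum// big1//.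
Qed.

Lemma rintegrable_bound s : (s < S)%N ->
  rintegrable Q (fun w => dlbar_bound f c zeta tau b (W w) k s).
Proof.
move=> sS; apply: rintegrableD.
  apply: rintegrableB; first exact: rintegrable_dl.
  by apply: rintegrableZ; exact: (cross_spec sS).1.
apply: rintegrableZ.
have := rintegrableZ zeta^-1 (rintegrable_grad_error k sS).
by under eq_fun do rewrite mulrC.
Qed.

Lemma rexp_bound_le s : (s < S)%N -> rintegrable Q (dist s) ->
  rexp Q (fun w => dlbar_bound f c zeta tau b (W w) k s) <=
  rexp Q (Dl s) + tau / zeta * (L ^+ 2 / b%:R) * rexp Q (dist s).
Proof.
move=> sS ir; have [iC EC] := cross_spec sS.
have iD := rintegrable_dl sS; have ie := rintegrable_grad_error k sS.
have -> : (fun w => dlbar_bound f c zeta tau b (W w) k s)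
  = fun w => (Dl s w - tau * cross s w) + (tau / zeta) * norm2 (grad_error f b (W w) k s) ^+ 2.
  by apply/funext => w; congr (_ + _); rewrite [LHS]mulrA mulrAC.
rewrite rexpD; [|by apply: rintegrableB => //; exact: rintegrableZ|exact: rintegrableZ].
rewrite rexpB//; last exact: rintegrableZ.
rewrite (rexpZ tau iC) (rexpZ (tau / zeta) ie) EC mulr0 subr0 lerD2l -[leRHS]mulrA.
have tz : 0 <= tau / zeta by rewrite divr_ge0 ?ltW.
exact: ler_wpM2l tz _ _ (rexp_grad_error_le sS ir).
Qed.

(** No bound on the iterates is at hand; integrability is propagated from the zero distance at
    [s = 0] by [dist_next]. *)
Lemma rintegrable_dist s : (s <= S)%N -> rintegrable Q (dist s).
Proof.
elim: s => [_|s IH sS].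
  rewrite (_ : dist 0 = fun=> 0); first exact: rintegrable_cst.
  by apply/funext => w; rewrite /dist subrr norm2_0 expr0n.
have ir := IH (ltnW sS).
(* The coefficient in [dist_next] for [z = 1]; any positive [z] would serve here. *)
pose K := (1 + 1) / 1 * ((au * beta) ^+ 2 / (kl * tau)).
apply: (rintegrable_dom (Y := fun w => (1 + 1) * dist s w
    + K * dlbar_bound f c zeta tau b (W w) k s)); first exact: measurable_dist.
  by apply: rintegrableD; apply: rintegrableZ => //; exact: rintegrable_bound.
apply: filterS ae_merit_event => w Ew; rewrite ger0_norm ?sqr_ge0//.
have [te _] := Ew _ _ ktk sS.
exact: (dist_next prob N_gt0 tau_gt0 L_gt0 Gam_ge0 beta_gt0 kl_gt0 zeta_gt0 al_au alb_le1
  (run w) (hess w) (X_W w) sS te (dlbar_lower Ew sS) ltr01).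
Qed.

(** The norm of [tr_d] is known when x_{k,s} is reached, so it is pulled out, after clipping, and
    the conditional bound [kd_ok] applies; Young's inequality then splits the product. *)
Lemma rexp_dshift_le s : (s < S)%N ->
  rintegrable Q (fun w => norm2 (tr_d (W w) k s) * shift_d s w) /\
  rexp Q (fun w => norm2 (tr_d (W w) k s) * shift_d s w) <=
  kd / 2 * (beta / (kl * tau) * rexp Q (Dl s) + beta^-1 * (L ^+ 2 / b%:R * rexp Q (dist s))).
Proof.
move=> sS; have [B B0 hB] := d_bounded ktk.
have [Z hZ ZM] := kd_ok k sS.
have iU : rintegrable Q (shift_d s) := ce_integrable hZ.
have iZ : rintegrable Q Z := ce_integrable_version hZ.
pose h w := clip B (norm2 (tr_d (W w) k s)).
have mh : @measurable_fun _ _ (TC k s) _ setT h.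
  apply: (@measurable_clip _ (TC k s)); apply: (@measurable_norm2 _ (TC k s)).
  exact: reached_d.
have hle w : `|h w| <= B by exact: clip_le.
have hE w : E w -> h w = norm2 (tr_d (W w) k s).
  by move=> Ew; rewrite /h clip_id// ger0_norm ?norm2_ge0// hB.
have mh' : measurable_fun setT h := coarse_measurable (reached_measurable sS) mh.
have ihU : rintegrable Q (fun w => h w * shift_d s w).
  by apply: (rintegrableM_bounded (M := B)) => //; exact/aeW.
have ihZ : rintegrable Q (fun w => h w * Z w).
  by apply: (rintegrableM_bounded (M := B)) => //; exact/aeW.
have eqU : {ae Q, forall w, norm2 (tr_d (W w) k s) * shift_d s w = h w * shift_d s w}.
  by apply: filterS ae_merit_event => w Ew; rewrite hE.
have i1 : rintegrable Q (fun w => norm2 (tr_d (W w) k s) * shift_d s w).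
  apply: rintegrable_ae_eq eqU => //; apply: measurable_funM.
    by apply: measurable_norm2; apply: (coarse_mx sS); exact: reached_d.
  exact: rintegrable_measurable iU.
split=> //; rewrite (eq_rexp_ae i1 ihU eqU).
have -> : rexp Q (fun w => h w * shift_d s w) = rexp Q (fun w => h w * Z w).
  apply/eqP; rewrite -subr_eq0 -rexpB//; apply/eqP.
  rewrite -(cond_exp_pullout (reached_measurable sS) hZ mh hle).
  by congr rexp; apply/funext => w; rewrite mulrBr.
have iD := rintegrable_dl sS; have ir := rintegrable_dist (ltnW sS).
rewrite -!rexpZ//; last exact: rintegrableZ.
rewrite -rexpD; [|exact: rintegrableZ|by do 2 apply: rintegrableZ].
rewrite -rexpZ; last by apply: rintegrableD; do ?apply: rintegrableZ.
apply: le_rexp_ae => //.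
  by apply: rintegrableZ; apply: rintegrableD; do ?apply: rintegrableZ.
apply: filterS2 ae_merit_event ZM => w Ew hZw; rewrite (hE _ Ew).
apply: le_trans (ler_wpM2l (norm2_ge0 _) hZw) _.
have M0 : 0 <= tr_M L b (W w) k s.
  by rewrite /tr_M mulr_ge0 ?sqr_ge0// divr_ge0 ?sqr_ge0// ler0n.
have := sqr_sqrtr M0; rewrite {2}/tr_M -/(dist s w) => <-.
have := dl_lower Ew sS.
move: (Num.sqrt _) (sqrtr_ge0 (tr_M L b (W w) k s)) => q q0.
move: (norm2 _) (norm2_ge0 (tr_d (W w) k s)) => r r0 hr.
have klt : 0 < kl * tau by rewrite mulr_gt0.
(* With weight [beta], and after the further factor [beta] in [phi_next], the step part is of order
   [beta ^ 2] and the distance part is free of [beta], as in the definitions of [Lam] and [lam]. *)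
have young : r * q <= 2^-1 * (beta * r ^+ 2 + beta^-1 * q ^+ 2).
  have := sqr_ge0 (beta * r - q); rewrite sqrrB exprMn => hy.
  rewrite -(ler_pM2l beta_gt0).
  have -> : beta * (2^-1 * (beta * r ^+ 2 + beta^-1 * q ^+ 2))
    = 2^-1 * (beta ^+ 2 * r ^+ 2 + q ^+ 2) by field; rewrite gt_eqF.
  lra.
have hr2 : beta * r ^+ 2 <= beta / (kl * tau) * Dl s w.
  by rewrite -mulrA ler_wpM2l ?(ltW beta_gt0)// ler_pdivlMl.
apply: (@le_trans _ _ (kd * (2^-1 * (beta * r ^+ 2 + beta^-1 * q ^+ 2)))).
  by rewrite mulrCA; apply: ler_wpM2l => //; exact: ltW.
by rewrite mulrA; apply: ler_wpM2l; [rewrite divr_ge0 ?ltW|rewrite lerD2r].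
Qed.

Lemma rintegrable_phi s : (s <= S)%N -> rintegrable Q (fun w => phi f c (tr_x (W w) k s) tau).
Proof.
move=> sS; have [B hB] := phi_bound prob tau.
apply: (rintegrable_bounded (M := B)).
  by apply: (measurable_phi prob (measurable_x k sS)) => w; exact: X_W.
by apply/aeW => w; apply: hB; exact: X_W.
Qed.

Variables (z : R) (lam : nat -> R).
Hypothesis z_gt0 : 0 < z.
Hypothesis lam_ge0 : forall s, (s <= S)%N -> 0 <= lam s.
Hypothesis lamS : lam S = 0.
Hypothesis lam_rec : forall s, (s < S)%N ->
  lam s = lam s.+1 * (1 + z)
     * (1 + au ^+ 2 * beta ^+ 2 * L ^+ 2 / (kl * z * b%:R * zeta))
   + au * tau * L ^+ 2 / (2 * b%:R) * (kH * kd + beta ^+ 2 / zeta).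
Let Lam s := al * beta - 2^-1 * au * beta ^+ 2
  - au * kH * kd * beta ^+ 2 / (2 * kl)
  - lam s.+1 * (1 + z) * (au ^+ 2 * beta ^+ 2 / (tau * kl * z)).

Let V s := rexp Q (fun w => phi f c (tr_x (W w) k s) tau) + lam s * rexp Q (dist s).

(** The recursion for [lam] balances the distance terms: the charges of the merit function and of
    the weighted next distance to [dist s] sum to [lam s], and the model reduction is left with
    coefficient [- Lam s]. *)
Lemma expected_step s : (s < S)%N -> V s.+1 <= V s - Lam s * rexp Q (Dl s).
Proof.
move=> sS; have iD := rintegrable_dl sS; have ir := rintegrable_dist (ltnW sS).
have ir1 := rintegrable_dist sS; have iphi := rintegrable_phi (ltnW sS).
have ib := rintegrable_bound sS; have [iU hU] := rexp_dshift_le sS.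
have hb := rexp_bound_le sS ir.
pose K1 := 2^-1 * au * beta ^+ 2.
pose K2 := au * beta * tau * kH.
pose K3 := (1 + z) / z * ((au * beta) ^+ 2 / (kl * tau)).
have h1 : rexp Q (fun w => phi f c (tr_x (W w) k s.+1) tau) <=
   rexp Q (fun w => phi f c (tr_x (W w) k s) tau) - al * beta * rexp Q (Dl s)
   + K1 * rexp Q (fun w => dlbar_bound f c zeta tau b (W w) k s)
   + K2 * rexp Q (fun w => norm2 (tr_d (W w) k s) * shift_d s w).
  rewrite -!rexpZ// -rexpB//; last exact: rintegrableZ.
  have i1 := rintegrableB iphi (rintegrableZ (al * beta) iD).
  have i2 := rintegrableD i1 (rintegrableZ K1 ib).
  rewrite -rexpD//; last exact: rintegrableZ.
  rewrite -rexpD//; last exact: rintegrableZ.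
  apply: le_rexp_ae; first exact: rintegrable_phi.
    by apply: rintegrableD => //; exact: rintegrableZ.
  apply: filterS ae_merit_event => w Ew; have [te _] := Ew _ _ ktk sS.
  exact: (phi_next prob N_gt0 tau_gt0 L_gt0 Gam_ge0 beta_gt0 kl_gt0 zeta_gt0 kH_gt0
    al_au alb_le1 (run w) (hess w) (X_W w) sS te (dl_lower Ew sS) (dlbar_lower Ew sS)).
have h2 : rexp Q (dist s.+1) <= (1 + z) * rexp Q (dist s)
   + K3 * rexp Q (fun w => dlbar_bound f c zeta tau b (W w) k s).
  rewrite -!rexpZ// -rexpD; [|exact: rintegrableZ|exact: rintegrableZ].
  apply: le_rexp_ae => //; first by apply: rintegrableD; exact: rintegrableZ.
  apply: filterS ae_merit_event => w Ew; have [te _] := Ew _ _ ktk sS.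
  exact: (dist_next prob N_gt0 tau_gt0 L_gt0 Gam_ge0 beta_gt0 kl_gt0 zeta_gt0 al_au alb_le1
    (run w) (hess w) (X_W w) sS te (dlbar_lower Ew sS) z_gt0).
have l1 := lam_ge0 sS.
have K10 : 0 <= K1 + lam s.+1 * K3.
  rewrite /K1 /K3 addr_ge0//; first by rewrite !mulr_ge0 ?invr_ge0 ?exprn_ge0 ?ltW.
  rewrite mulr_ge0// mulr_ge0 ?divr_ge0 ?sqr_ge0 ?addr_ge0 ?(ltW z_gt0)//.
  by rewrite mulr_ge0 ?ltW.
have K20 : 0 <= K2 by rewrite /K2 !mulr_ge0 ?ltW.
have h3 := ler_wpM2l l1 h2; have h4 := ler_wpM2l K10 hb; have h5 := ler_wpM2l K20 hU.
rewrite mulrDr [lam s.+1 * (K3 * _)]mulrA in h3.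
rewrite /V (lam_rec sS); apply: le_trans (merit_combine h1 h3 h4 h5) _.
have bR : b%:R != 0 :> R by rewrite pnatr_eq0 -lt0n.
(* The remaining inequality is an identity once [lam s] is expanded. *)
rewrite le_eqVlt; apply/orP; left; apply/eqP; rewrite /Lam /K1 /K2 /K3.
move: (rexp Q (dist s)) (rexp Q (Dl s)) (lam s.+1) (al) (rexp _ _) => r D l a p.
by field; rewrite ?bR ?gt_eqF.
Qed.

(** The Lyapunov function [V] equals the mean merit value at both ends: the distance vanishes at
    [s = 0] and its weight at [s = S]. *)
Lemma outer_step (nu : R) : (forall s, (s < S)%N -> nu <= Lam s) ->
  nu * \sum_(s < S) rexp Q (Dl s) <=
  rexp Q (fun w => phi f c (tr_x (W w) k 0) tau)
    - rexp Q (fun w => phi f c (tr_x (W w) k.+1 0) tau).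
Proof.
move=> hnu.
have H j : (j <= S)%N -> nu * \sum_(s < j) rexp Q (Dl s) <= V 0 - V j.
  elim: j => [_|j IH jS]; first by rewrite big_ord0 mulr0 subrr.
  rewrite big_ord_recr /= mulrDr.
  have D0 : 0 <= rexp Q (Dl j).
    apply: rexp_ge0_ae; first exact: rintegrable_dl.
    by apply: filterS ae_merit_event => w Ew; exact: dl_ge0.
  exact: telescope_step (IH (ltnW jS)) (expected_step jS) (ler_wpM2r D0 (hnu _ jS)).
have := H S (leqnn S); rewrite /V lamS mul0r addr0.
have -> : rexp Q (dist 0) = 0.
  rewrite (_ : dist 0 = fun=> 0) ?rexp_cst//.
  by apply/funext => w; rewrite /dist subrr norm2_0 expr0n.
rewrite mulr0 addr0.
by under [in X in _ -> _ <= _ - X]eq_fun do rewrite (run_x_outer (run _)).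
Qed.

End AfterKt.

(** * Summation over outer iterations *)

Section Telescope.
Variables (z nu : R) (lam : nat -> R).
Hypothesis z_gt0 : 0 < z.
Hypothesis lam_ge0 : forall s, (s <= S)%N -> 0 <= lam s.
Hypothesis lamS : lam S = 0.
Hypothesis lam_rec : forall s, (s < S)%N ->
  lam s = lam s.+1 * (1 + z)
     * (1 + au ^+ 2 * beta ^+ 2 * L ^+ 2 / (kl * z * b%:R * zeta))
   + au * tau * L ^+ 2 / (2 * b%:R) * (kH * kd + beta ^+ 2 / zeta).
Hypothesis nu_le : forall s, (s < S)%N ->
  nu <= al * beta - 2^-1 * au * beta ^+ 2 - au * kH * kd * beta ^+ 2 / (2 * kl)
    - lam s.+1 * (1 + z) * (au ^+ 2 * beta ^+ 2 / (tau * kl * z)).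
Hypothesis phi_lb : has_lbound [set phi f c x tau | x in X].

Lemma phi_inf_le k : phi_inf f c X tau <= rexp Q (fun w => phi f c (tr_x (W w) k 0) tau).
Proof.
rewrite -[leLHS](rexp_cst Q); apply: le_rexp_ae; first exact: rintegrable_cst.
  exact: rintegrable_phi.
apply/aeW => w; apply: ge_inf => //; exists (tr_x (W w) k 0) => //; exact: X_W.
Qed.

Lemma total_decrease k : (kt <= k)%N ->
  rintegrable Q (fun w => \sum_(kt <= j < k.+1) \sum_(s < S) tr_dl f c (W w) tau j s) /\
  nu * rexp Q (fun w => \sum_(kt <= j < k.+1) \sum_(s < S) tr_dl f c (W w) tau j s) <=
  rexp Q (fun w => phi f c (tr_x (W w) kt 0) tau) - phi_inf f c X tau.
Proof.
move=> ktk.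
have iS j : (kt <= j)%N -> rintegrable Q (fun w => \sum_(s < S) tr_dl f c (W w) tau j s).
  by move=> ktj; apply: rintegrable_sum => s; exact: rintegrable_dl.
(* Reindexing from 0 makes every summand index at least [kt], so that all summands are integrable,
   as [rexp_sum] requires. *)
have -> : (fun w => \sum_(kt <= j < k.+1) \sum_(s < S) tr_dl f c (W w) tau j s)
  = fun w => \sum_(0 <= j < k.+1 - kt) \sum_(s < S) tr_dl f c (W w) tau (j + kt) s.
  by apply/funext => w; rewrite -{1}[kt]add0n big_addn.
split; first by apply: rintegrable_sum => j; apply: iS; exact: leq_addl.
rewrite rexp_sum; last by move=> j; apply: iS; exact: leq_addl.
pose ph j := rexp Q (fun w => phi f c (tr_x (W w) j 0) tau).
apply: (@le_trans _ _ (ph kt - ph (k.+1 - kt + kt)%N)); last first.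
  by rewrite lerD2l lerN2; exact: phi_inf_le.
elim: (k.+1 - kt)%N => [|j IH]; first by rewrite big_geq// mulr0 add0n subrr.
rewrite big_nat_recr//= mulrDr addSn.
have ktj : (kt <= j + kt)%N by exact: leq_addl.
have h := outer_step ktj z_gt0 lam_ge0 lamS lam_rec nu_le.
rewrite rexp_sum; last by move=> s; exact: rintegrable_dl.
have -> : ph kt - ph (j + kt).+1 = (ph kt - ph (j + kt)%N) + (ph (j + kt)%N - ph (j + kt).+1).
  by rewrite addrA subrK.
exact: lerD IH h.
Qed.

End Telescope.

End RandomStep.

(** * Choice of the universal constants and assembly of the two bounds *)

Unset Implicit Arguments.
Set Strict Implicit.

Theorem theorem4p19 (R : realType) (n m : nat)
    (L : R) (gam : 'I_m -> R) (zeta kH kl kd taumin au gamma : R)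
    (hL : 0 < L) (hgam : forall i, 0 < gam i)
    (hzeta : 0 < zeta) (hkH : 0 < kH) (hkl : 0 < kl) (hkd : 0 < kd)
    (htaumin : 0 < taumin) (hau : 0 < au)
    (hgamma0 : 0 < gamma) (hgamma1 : gamma <= 1) :
  let Gam := \sum_(i < m) gam i in
  let A := taumin * L + Gam in
  let al := kl * taumin / A in
  al < au ->
  exists mu1 nu1 : R,
  [/\ 0 < mu1, mu1 <= 1, 0 < nu1 &
  forall (N b S : nat),
  (1 <= b)%N -> (b <= N - 1)%N -> b%:R < N%:R `^ gamma ->
  let beta := mu1 * b%:R / (A * N%:R `^ gamma) in
  let z := A / N%:R `^ (gamma / 2) in
  0 < beta -> beta <= 1 ->
  0 < beta * kl * taumin / A -> beta * kl * taumin / A <= 1 ->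
  (1 <= S)%N ->
  S%:Z <= Num.floor (N%:R `^ (gamma / 2) /
            (A + mu1 ^+ 2 * au ^+ 2 * L ^+ 2 * b%:R / (A ^+ 3 * kl * zeta)
               + mu1 ^+ 2 * au ^+ 2 * L ^+ 2 * b%:R / (A ^+ 2 * kl * zeta))) ->
  forall (X : set 'cV[R]_n) (f : 'I_N -> 'cV[R]_n -> R)
    (c : 'cV[R]_n -> 'cV[R]_m),
  smooth_problem X f c L gam ->
  has_lbound [set phi f c x taumin | x in X] ->
  forall (sigma epstau tauinit : R) (xinit : 'cV[R]_n),
  0 < sigma -> sigma < 1 -> 0 < epstau -> epstau < 1 -> 0 < tauinit ->
  forall (disp : measure_display) (T : measurableType disp)
    (P : probability T R) (W : T -> trajectory R n m N),
  random_run W S ->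
  (forall w, vr_sqp_run f c L Gam sigma epstau au beta b S xinit tauinit (W w)) ->
  (forall w k s, (s <= S)%N -> X (tr_x (W w) k s)) ->
  (forall w, hessian_ok c zeta kH S (W w)) ->
  forall (kt : nat),
  let E := merit_event f c sigma taumin S kt W in
  measurable E -> (0 < P E)%E ->
  forall Q : probability T R, conditioned_on P Q E ->
  gradient_estimates W Q f L b S ->
  (forall w k s, E w -> (s < S)%N ->
     kl * tr_taubar (W w) k s * norm2 (tr_d (W w) k s) ^+ 2
       <= tr_dl f c (W w) (tr_taubar (W w) k s) k s /\
     kl * tr_taubar (W w) k s * norm2 (tr_dbar (W w) k s) ^+ 2
       <= tr_dlbar f c b (W w) (tr_taubar (W w) k s) k s) ->
  (forall k s, (s < S)%N ->
     cond_exp_le Q (reached W k s)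
       (fun w => norm2 (tr_dbar (W w) k s - tr_d (W w) k s))
       (fun w => kd * Num.sqrt (tr_M L b (W w) k s))) ->
  forall lam : nat -> R,
  lam S = 0 ->
  (forall s, (s < S)%N ->
     lam s = lam s.+1 * (1 + z)
               * (1 + au ^+ 2 * beta ^+ 2 * L ^+ 2 / (kl * z * b%:R * zeta))
             + au * taumin * L ^+ 2 / (2 * b%:R)
               * (kH * kd + beta ^+ 2 / zeta)) ->
  let Lam s := al * beta - 2^-1 * au * beta ^+ 2
               - au * kH * kd * beta ^+ 2 / (2 * kl)
               - lam s.+1 * (1 + z) * (au ^+ 2 * beta ^+ 2 / (taumin * kl * z)) in
  let Lammin := \big[Num.min/Lam 0%N]_(s < S) Lam s in
  nu1 * b%:R / (A * N%:R `^ gamma) <= Lammin /\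
  (forall k : nat, (kt <= k)%N ->
     ('E_Q[ (fun w => (((k - kt + 1)%:R * S%:R)^-1 *
               \sum_(kt <= j < k.+1) \sum_(s < S)
                  tr_dl f c (W w) taumin j s)%R) ]
      <= (A * N%:R `^ gamma)%R%:E
         * ('E_Q[ (fun w => phi f c (tr_x (W w) kt 0) taumin) ]
            - (phi_inf f c X taumin)%:E)
         * (((k - kt + 1)%:R * S%:R * nu1 * b%:R)^-1)%R%:E)%E)].
Proof.
move=> Gam A al al_au.
have Gam0 : 0 <= Gam by apply: sumr_ge0 => i _; exact: ltW.
have A0 : 0 < A by rewrite /A ltr_wpDr// mulr_gt0.
pose mu := step_mu A kl taumin au L zeta kH kd.
have mu0 : 0 < mu by exact: step_mu_gt0.
have al0 : 0 < al by rewrite /al divr_gt0// mulr_gt0.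
(* The second constant is the half of [al * beta] left by [Lam_lower], without its factor
   [b / (A * N^gamma)]. *)
exists mu, (mu * al / 2); split => //; first exact: step_mu_le1.
  by rewrite divr_gt0// mulr_gt0.
move=> N b S b1 bN.
have N0 : (0 < N)%N := leq_trans b1 (leq_trans bN (leq_subr 1 N)).
have ME : N%:R `^ gamma = N%:R `^ (gamma / 2) * N%:R `^ (gamma / 2) :> R.
  rewrite -powRD -?splitr//.
  by apply/implyP => _; rewrite pnatr_eq0 -lt0n.
(* From here on N^(gamma / 2) is an abstract real [h], and N^gamma becomes [h * h]. *)
move: (N%:R `^ gamma) (N%:R `^ (gamma / 2)) (powR_ge0 (N%:R : R) (gamma / 2)) ME.
move=> M h h0 -> {M} bh beta z beta0 beta_le1 _ alb S1 S_floor.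
move=> X f c prob phi_lb sigma epstau tauinit xinit _ _ _ _ _ disp T P W rr run X_W hess kt E mE _.
move=> Q condQ ge kl_ok kd_ok lam lamS lam_rec Lam Lammin.
have b1R : 1 <= b%:R :> R by rewrite ler1n.
have h1 : 1 <= h.
  (* Otherwise [b < h * h <= 1], against [1 <= b]. *)
  rewrite leNgt; apply/negP => h1.
  have : h * h <= 1 by rewrite mulr_ile1// ltW.
  by rewrite leNgt (le_lt_trans b1R bh).
have hS : S%:R <= h / (A + mu ^+ 2 * au ^+ 2 * L ^+ 2 * b%:R / (A ^+ 3 * kl * zeta)
               + mu ^+ 2 * au ^+ 2 * L ^+ 2 * b%:R / (A ^+ 2 * kl * zeta)).
  by move: S_floor; rewrite real_floor_ge_int ?num_real.
have lam_rec' s : (s < S)%N -> lam s = lam s.+1 * ((1 + z)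
      * (1 + au ^+ 2 * beta ^+ 2 * L ^+ 2 / (kl * z * b%:R * zeta)))
    + au * taumin * L ^+ 2 / (2 * b%:R) * (kH * kd + beta ^+ 2 / zeta).
  by move=> sS; rewrite lam_rec// [in RHS]mulrA.
have lam_ge0 : forall s, (s <= S)%N -> 0 <= lam s.
  exact: (lam_ge0 A0 hkl htaumin hau hL hzeta hkH hkd h1 b1R lamS lam_rec').
have Lam_ge s : (s < S)%N -> mu * al / 2 * b%:R / (A * (h * h)) <= Lam s.
  exact: (Lam_lower A0 hkl htaumin hau hL hzeta hkH hkd h1 b1R (ltW bh) beta_le1 hS lamS lam_rec').
split.
  (* The default value [Lam 0] of the minimum belongs to the family, as [S >= 1]. *)
  by apply: le_bigmin => [|s _]; [exact: Lam_ge|exact: Lam_ge].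
move=> k ktk.
have z0 : 0 < z by rewrite divr_gt0// (lt_le_trans ltr01).
have alb1 : al * beta <= 1 by rewrite mulrC /al mulrA mulrA.
have [iD hD] := total_decrease prob N0 htaumin hL Gam0 beta0 hkl hkd hzeta hkH hau b1
  al_au alb1 S1 rr run X_W hess mE condQ ge kl_ok kd_ok z0 lam_ge0 lamS lam_rec Lam_ge phi_lb ktk.
rewrite expectation_rexp; last exact: rintegrableZ.
rewrite expectation_rexp; last first.
  exact: (rintegrable_phi prob taumin S1 Q rr run X_W kt (leq0n S)).
rewrite -EFinB -!EFinM lee_fin rexpZ//.
have h_gt0 : 0 < h by exact: lt_le_trans h1.
have nu0 : 0 < mu * al / 2 * b%:R / (A * (h * h)).
  by rewrite !(divr_gt0, mulr_gt0, ltr0n).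
have K0 : 0 < (k - kt + 1)%:R * S%:R :> R by rewrite mulr_gt0// ltr0n// addn1.
move: hD; rewrite mulrC -ler_pdivlMr// => hD.
rewrite mulrC ler_pdivrMr//; apply: (le_trans hD).
(* Dividing by the lower bound on [Lam] and by [(k - kt + 1) * S] yields exactly the stated
   right-hand side. *)
rewrite le_eqVlt; apply/orP; left; apply/eqP; move: (_ - _) nu0 K0 => D nu0 K0.
have v0 : 0 < mu * al / 2 by rewrite divr_gt0// mulr_gt0.
have bR0 : 0 < b%:R :> R by rewrite ltr0n.
move: (_ * S%:R) K0 (mu * al / 2) v0 => K K0 v v0.
by field; rewrite !gt_eqF.
Qed.
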